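(* For a metric space $X$, the following conditions are equivalent: (1) $X$ is a Lipschitz image of a separable injective metric space; (2) $X$ is a Lipschitz image of a separable complete $\mathbb{R}$-tree; (3) $X$ is a $1$-Lipschitz image of the Urysohn universal metric space; (4) $X$ is analytic, Lipschitz connected, and its intrinsic metric $d_{IX}$ is separable.
   Context: The metric of a metric space $X$ is denoted $d_X$. For a map $f:X\to Y$ between metric spaces, $\operatorname{Lip}(f):=\sup_{x\ne x'}\frac{d_Y(f(x),f(x'))}{d_X(x,x')}\in[0,\infty]$ (with $\sup\varnothing=0$). The map $f$ is Lipschitz if $\operatorname{Lip}(f)<\infty$, and $L$-Lipschitz (for a real number $L$) if $\operatorname{Lip}(f)\le L$. A metric space $Y$ is a Lipschitz image (resp. $1$-Lipschitz image) of a metric space $X$ if there exists a surjective Lipschitz map $f:X\to Y$ (resp. with $\operatorname{Lip}(f)\le 1$). A metric space $X$ is injective if every $1$-Lipschitz map $f:B\to X$ defined on a subspace $B$ of a metric space $A$ extends to a $1$-Lipschitz map $\bar f:A\to X$. For points $x,y$ of a metric space $X$, the metric segment is $[x,y]:=\{z\in X:d_X(x,y)=d_X(x,z)+d_X(z,y)\}$. A metric space $X$ is an $\mathbb{R}$-tree if for all $x,y\in X$ the metric segment $[x,y]$ is isometric to the interval $[0,d_X(x,y)]$ of the real line, and for all $x,y,z\in X$ with $[x,y]\cap[y,z]=\{y\}$ we have $d_X(x,z)=d_X(x,y)+d_X(y,z)$. A topological space is analytic if it is a continuous image of a separable complete metric space. The Urysohn universal metric space is the (unique up to isometry) complete separable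 metric space $\mathbb{U}$ such that any isometric embedding into $\mathbb{U}$ of a subset $A$ of a finite metric space $B$ extends to an isometric embedding of $B$ into $\mathbb{U}$. A metric space $X$ is Lipschitz connected if for all points $x,y\in X$ there exists a Lipschitz map $f:[0,1]\to X$ with $f(0)=x$ and $f(1)=y$. Every Lipschitz connected metric space $X$ carries the intrinsic metric $d_{IX}(x,y):=\inf\{\operatorname{Lip}(f): f:[0,1]\to X,\ f(0)=x,\ f(1)=y\}$. A metric $d$ on a set $X$ is called separable if the metric space $(X,d)$ is separable. *)

(* Defs.v *)
From HB Require Import structures.
From mathcomp Require Import all_boot all_order all_algebra.
From mathcomp Require Import all_classical all_reals all_analysis.
From mathcomp Require Import lra.

Set Implicit Arguments.
Unset Strict Implicit.
Unset Printing Implicit Defensive.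

Import Order.TTheory GRing.Theory Num.Theory.

Local Open Scope classical_set_scope.
Local Open Scope ring_scope.

Section subset_metric.
Context {R : realType} {X : metricType R} (A : set X).

Definition subset_mdist (x y : A) : R := mdist (set_val x) (set_val y).

Let subset_mdist_ge0 x y : 0 <= subset_mdist x y.
Proof. exact: mdist_ge0. Qed.

Let subset_mdist_positivity x y : subset_mdist x y = 0 -> x = y.
Proof. by move=> /mdist_positivity /val_inj. Qed.

Let ballE_subset_mdist (x : A) (d : R) :
  ball x d = [set y | subset_mdist x y < d].
Proof.
by rewrite -[LHS]/(set_val @^-1` ball (set_val x) d) ballEmdist.
Qed.

HB.instance Definition _ := @PseudoMetric_isMetric.Build R (set_type A)
  subset_mdist subset_mdist_ge0 subset_mdist_positivity ballE_subset_mdist.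

End subset_metric.

Section lipschitz.
Context {R : realType}.
Implicit Types X Y : metricType R.

(* Adding 0 to the set of (nonnegative) quotients implements the convention
   that the supremum of the empty set is 0, whereas [ereal_sup set0 = -oo]. *)
Definition Lip X Y (f : X -> Y) : \bar R :=
  ereal_sup (0%E |` [set (mdist (f p.1) (f p.2) / mdist p.1 p.2)%:E |
                      p in [set p : X * X | p.1 <> p.2]]).

Definition lipschitz_map X Y (f : X -> Y) := (Lip f < +oo)%E.

Definition lipschitz_with (L : R) X Y (f : X -> Y) := (Lip f <= L%:E)%E.

Definition surjective (T U : Type) (f : T -> U) := range f = [set: U].

(* [Y] is a Lipschitz image of [X]. *)
Definition lipschitz_image_of Y X :=
  exists f : X -> Y, surjective f /\ lipschitz_map f.

Definition lipschitz1_image_of Y X :=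
  exists f : X -> Y, surjective f /\ lipschitz_with 1 f.

Definition isometric_embedding X Y (f : X -> Y) :=
  forall x x', mdist (f x) (f x') = mdist x x'.

Definition isometric X Y :=
  exists f : X -> Y, isometric_embedding f /\ surjective f.

Definition injective_space X :=
  forall (A : metricType R) (B : set A) (f : B -> X), lipschitz_with 1 f ->
    exists g : A -> X, lipschitz_with 1 g /\ forall b : B, g (set_val b) = f b.

Definition separable X := exists2 D : set X, countable D & dense D.

Definition complete_space X :=
  forall F : set_system X, ProperFilter F -> cauchy F -> exists l : X, F --> l.

Definition segment X (x y : X) : set X :=
  [set z | mdist x y = mdist x z + mdist z y].

(* The metric of the reals is carried by the alias [R^o]. *)
Definition real_itv (a b : R) : set R^o := [set t | a <= t <= b].

Definition R_tree X :=
  (forall x y : X, isometric (segment x y) (real_itv 0 (mdist x y))) /\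
  (forall x y z : X, segment x y `&` segment y z = [set y] ->
    mdist x z = mdist x y + mdist y z).

Definition urysohn_space X :=
  [/\ complete_space X, separable X &
      forall (B : metricType R) (A : set B) (f : A -> X),
        finite_set [set: B] -> isometric_embedding f ->
        exists g : B -> X,
          isometric_embedding g /\ forall a : A, g (set_val a) = f a].

(* Explicit [R]: the metric space of which [X] is a continuous image takes its
   distances in [R]. *)
Definition analytic (X : topologicalType) :=
  exists Z : metricType R, [/\ separable Z, complete_space Z &
    exists f : Z -> X, continuous f /\ surjective f].

Definition unit_itv : set R^o := real_itv 0 1.

Lemma unit_itv0_subproof : (0 : R^o) \in unit_itv.
Proof. by apply/mem_set; rewrite /unit_itv /real_itv/= lexx ler01. Qed.

Lemma unit_itv1_subproof : (1 : R^o) \in unit_itv.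
Proof. by apply/mem_set; rewrite /unit_itv /real_itv/= lexx ler01. Qed.

Definition unit_itv0 : unit_itv := SigSub unit_itv0_subproof.
Definition unit_itv1 : unit_itv := SigSub unit_itv1_subproof.

Definition path_from_to X (x y : X) : set (unit_itv -> X) :=
  [set f | f unit_itv0 = x /\ f unit_itv1 = y].

Definition lipschitz_connected X :=
  forall x y : X,
    exists2 f : unit_itv -> X, lipschitz_map f & path_from_to x y f.

Definition intrinsic_edist X (x y : X) : \bar R :=
  ereal_inf [set Lip f | f in path_from_to x y].

Definition intrinsic_mdist X (x y : X) : R := fine (intrinsic_edist x y).

End lipschitz.
Arguments analytic : clear implicits.
Arguments unit_itv : clear implicits.

Section lipschitz_lemmas.
Context {R : realType}.
Implicit Types X Y : metricType R.

Lemma Lip_ge0 X Y (f : X -> Y) : (0 <= Lip f)%E.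
Proof. by apply: ereal_sup_ubound; left. Qed.

Lemma LipP X Y (f : X -> Y) (L : R) : 0 <= L ->
  (Lip f <= L%:E)%E <-> forall x x', mdist (f x) (f x') <= L * mdist x x'.
Proof.
move=> L0; split=> [fL x x'|fL].
  have [->|xx'] := eqVneq x x'; first by rewrite !mdistxx mulr0.
  rewrite -ler_pdivrMr ?mdist_gt0// -lee_fin; apply: le_trans fL.
  by apply: ereal_sup_ubound; right; exists (x, x') => //=; exact/eqP.
apply: ge_ereal_sup => _ [->|[[x x'] /= /eqP xx'] <-].
  by rewrite lee_fin.
by rewrite lee_fin ler_pdivrMr ?mdist_gt0.
Qed.

Definition unit_itv_clamp (t : R) : R^o := Num.max 0 (Num.min t 1).

Lemma unit_itv_clamp_subproof (t : R) : unit_itv_clamp t \in unit_itv R.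
Proof.
apply/mem_set; rewrite /unit_itv /real_itv/= /unit_itv_clamp.
by rewrite le_max lexx/= ge_max ler01 ge_min lexx orbT.
Qed.

Definition to_unit_itv (t : R) : unit_itv R :=
  SigSub (unit_itv_clamp_subproof t).

Lemma mdist_unit_itvE (s t : unit_itv R) :
  mdist s t = `|(val t : R) - val s|.
Proof. by []. Qed.

Lemma unit_itvP (t : unit_itv R) : 0 <= (val t : R) <= 1.
Proof. by have /set_mem := valP t. Qed.

Lemma val_to_unit_itv (t : R) : 0 <= t <= 1 -> val (to_unit_itv t) = t.
Proof.
by move=> /andP[t0 t1]; rewrite /= /unit_itv_clamp min_l// max_r.
Qed.

Lemma to_unit_itv_val (t : unit_itv R) : to_unit_itv (val t) = t.
Proof. by apply: val_inj; rewrite val_to_unit_itv// unit_itvP. Qed.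

Lemma to_unit_itv0 : to_unit_itv 0 = unit_itv0.
Proof. by rewrite -(to_unit_itv_val unit_itv0). Qed.

Lemma to_unit_itv1 : to_unit_itv 1 = unit_itv1.
Proof. by rewrite -(to_unit_itv_val unit_itv1). Qed.

Definition rev_path X (f : unit_itv R -> X) (t : unit_itv R) : X :=
  f (to_unit_itv (1 - val t)).

Definition concat_path X (s : R) (f g : unit_itv R -> X) (t : unit_itv R) : X :=
  if (val t : R) <= s then f (to_unit_itv (val t / s))
  else g (to_unit_itv ((val t - s) / (1 - s))).

Lemma rev_path_from_to X (x y : X) f :
  path_from_to x y f -> path_from_to y x (rev_path f).
Proof.
move=> [f0 f1]; split; rewrite /rev_path/=.
  by rewrite subr0 to_unit_itv1.
by rewrite subrr to_unit_itv0.
Qed.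

Lemma Lip_rev_path X (f : unit_itv R -> X) (L : R) : 0 <= L ->
  (Lip f <= L%:E)%E -> (Lip (rev_path f) <= L%:E)%E.
Proof.
move=> L0 /(LipP _ L0) fL; apply/LipP => // s t.
apply: le_trans (fL _ _) _; rewrite !mdist_unit_itvE.
have s01 := unit_itvP s; have t01 := unit_itvP t.
rewrite !val_to_unit_itv; [|lra|lra].
by rewrite ler_wpM2l// opprB addrC subrKA distrC.
Qed.

Lemma concat_path_from_to X (x y z : X) (s : R) f g : 0 < s < 1 ->
  path_from_to x y f -> path_from_to y z g ->
  path_from_to x z (concat_path s f g).
Proof.
move=> /andP[s0 s1] [f0 f1] [g0 g1]; split; rewrite /concat_path/=.
  by rewrite ltW// mul0r to_unit_itv0.
by rewrite leNgt s1/= divff ?to_unit_itv1// subr_eq0 gt_eqF.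
Qed.

Lemma Lip_concat_path X (x y z : X) f g (L1 L2 : R) : 0 < L1 -> 0 < L2 ->
  path_from_to x y f -> path_from_to y z g ->
  (Lip f <= L1%:E)%E -> (Lip g <= L2%:E)%E ->
  (Lip (concat_path (L1 / (L1 + L2)) f g) <= (L1 + L2)%:E)%E.
Proof.
move=> L10 L20 [f0 f1] [g0 g1] /(LipP _ (ltW L10)) fL /(LipP _ (ltW L20)) gL.
have L0 : 0 < L1 + L2 by rewrite addr_gt0.
apply/LipP => [|a b]; first exact: ltW.
set s := L1 / (L1 + L2).
have s0 : 0 < s by rewrite divr_gt0.
have sE : (L1 + L2) * s = L1 by rewrite mulrC divfK// gt_eqF.
have s'E : (L1 + L2) * (1 - s) = L2 by rewrite mulrBr sE; lra.
have s1 : 0 < 1 - s by rewrite -(pmulr_rgt0 _ L0) s'E.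
have fE (u v : R) : 0 <= u <= s -> 0 <= v <= s ->
    mdist (f (to_unit_itv (u / s))) (f (to_unit_itv (v / s)))
    <= (L1 + L2) * `|v - u|.
  move=> us vs; apply: le_trans (fL _ _) _; rewrite mdist_unit_itvE.
  rewrite !val_to_unit_itv ?divr_ge0 ?ler_pdivrMr ?mul1r//=; try lra.
  rewrite -mulrBl normrM normfV (gtr0_norm s0) -{1}sE -[leLHS]mulrA.
  by rewrite ler_wpM2l ?(ltW L0)// [leLHS]mulrC divfK// gt_eqF.
have gE (u v : R) : s <= u <= 1 -> s <= v <= 1 ->
    mdist (g (to_unit_itv ((u - s) / (1 - s))))
          (g (to_unit_itv ((v - s) / (1 - s))))
    <= (L1 + L2) * `|v - u|.
  move=> us vs; apply: le_trans (gL _ _) _; rewrite mdist_unit_itvE.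
  rewrite !val_to_unit_itv; last 2 first.
  - by apply/andP; split; [rewrite divr_ge0|rewrite ler_pdivrMr// mul1r]; lra.
  - by apply/andP; split; [rewrite divr_ge0|rewrite ler_pdivrMr// mul1r]; lra.
  rewrite -mulrBl normrM normfV (gtr0_norm s1).
  have -> : v - s - (u - s) = v - u by lra.
  rewrite -{1}s'E -[leLHS]mulrA.
  by rewrite ler_wpM2l ?(ltW L0)// [leLHS]mulrC divfK// gt_eqF.
have fs : f (to_unit_itv (s / s)) = y.
  by rewrite divff ?gt_eqF// to_unit_itv1.
have gs : g (to_unit_itv ((s - s) / (1 - s))) = y.
  by rewrite subrr mul0r to_unit_itv0.
have a01 := unit_itvP a; have b01 := unit_itvP b.
rewrite mdist_unit_itvE /concat_path; move: a01 b01.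
move: (val a : R) (val b : R) => u v u01 v01.
case: ifPn => us; case: ifPn => vs; rewrite -?ltNge in us vs.
- by apply: fE; lra.
- apply: le_trans (metric_triangle _ y _) _.
  rewrite -{1}fs -gs (@ger0_norm _ (v - u)); last lra.
  have -> : v - u = `|s - u| + `|v - s| by rewrite !ger0_norm; lra.
  by rewrite mulrDr lerD// ?fE ?gE; lra.
- apply: le_trans (metric_triangle _ y _) _.
  rewrite -{1}gs -fs (@ler0_norm _ (v - u)); last lra.
  have -> : - (v - u) = `|s - u| + `|v - s| by rewrite !ler0_norm; lra.
  by rewrite mulrDr lerD// ?fE ?gE; lra.
- by apply: gE; lra.
Qed.

End lipschitz_lemmas.

(* [X] with its intrinsic metric; the proof of Lipschitz connectedness ensures
   that the infimum defining the metric is finite. *)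
Definition intrinsic_space (R : realType) (X : metricType R)
  (cX : lipschitz_connected X) : Type := X.

Section intrinsic_metric.
Context {R : realType} {X : metricType R} (cX : lipschitz_connected X).
Implicit Types x y z : X.

Let edist_ge0 x y : (0 <= intrinsic_edist x y)%E.
Proof. by apply: le_ereal_inf_tmp => _ [f _ <-]; exact: Lip_ge0. Qed.

Let edist_fin x y : intrinsic_edist x y \is a fin_num.
Proof.
rewrite ge0_fin_numE//; have [f fL fxy] := cX x y.
by apply: le_lt_trans fL; apply: ereal_inf_lbound; exists f.
Qed.

Let mdist_path x y (L : R) : intrinsic_mdist x y < L ->
  exists2 f, path_from_to x y f & (Lip f <= L%:E)%E.
Proof.
rewrite -lte_fin fineK// => /ereal_inf_lt[_ [f fxy <-]] /ltW fL.
by exists f.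
Qed.

Let mdist_le x y f (L : R) : path_from_to x y f -> (Lip f <= L%:E)%E ->
  intrinsic_mdist x y <= L.
Proof.
move=> fxy fL; rewrite -lee_fin fineK//; apply: le_trans fL.
by apply: ereal_inf_lbound; exists f.
Qed.

Let mdist_ge0 x y : 0 <= intrinsic_mdist x y.
Proof. exact: fine_ge0. Qed.

Let mdistxx x : intrinsic_mdist x x = 0.
Proof.
apply/eqP; rewrite eq_le mdist_ge0 andbT.
apply: (@mdist_le _ _ (fun=> x)) => //; apply/LipP => // s t.
by rewrite mdistxx mul0r.
Qed.

Let mdist_sym x y : intrinsic_mdist x y = intrinsic_mdist y x.
Proof.
have H (u v : X) : intrinsic_mdist u v <= intrinsic_mdist v u.
  apply/ler_addgt0Pl => e e0.
  have [f fvu fL] : exists2 f, path_from_to v u f &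
      (Lip f <= (e + intrinsic_mdist v u)%:E)%E.
    by apply: mdist_path; rewrite ltrDr.
  apply: (mdist_le (rev_path_from_to fvu)); apply: Lip_rev_path => //.
  by rewrite addr_ge0// ltW.
by apply/eqP; rewrite eq_le !H.
Qed.

Let mdist_triangle y x z :
  intrinsic_mdist x z <= intrinsic_mdist x y + intrinsic_mdist y z.
Proof.
apply/ler_addgt0Pl => e e0.
have xy0 := mdist_ge0 x y; have yz0 := mdist_ge0 y z.
pose L1 := intrinsic_mdist x y + e / 2; pose L2 := intrinsic_mdist y z + e / 2.
have [f fxy fL] : exists2 f, path_from_to x y f & (Lip f <= L1%:E)%E.
  by apply: mdist_path; rewrite /L1; lra.
have [g gyz gL] : exists2 g, path_from_to y z g & (Lip g <= L2%:E)%E.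
  by apply: mdist_path; rewrite /L2; lra.
have L10 : 0 < L1 by rewrite /L1; lra.
have L20 : 0 < L2 by rewrite /L2; lra.
have -> : e + (intrinsic_mdist x y + intrinsic_mdist y z) = L1 + L2.
  by rewrite /L1 /L2; lra.
apply: mdist_le (Lip_concat_path L10 L20 fxy gyz fL gL).
apply: (concat_path_from_to _ fxy gyz).
have L0 : 0 < L1 + L2 by rewrite addr_gt0.
by apply/andP; split; [rewrite divr_gt0|rewrite ltr_pdivrMr// mul1r ltrDl].
Qed.

Lemma mdist_le_intrinsic x y : mdist x y <= intrinsic_mdist x y.
Proof.
apply/ler_addgt0Pl => e e0.
have [f [f0 f1] fL] : exists2 f, path_from_to x y f &
    (Lip f <= (e + intrinsic_mdist x y)%:E)%E.
  by apply: mdist_path; rewrite ltrDr.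
have L0 : 0 <= e + intrinsic_mdist x y by rewrite addr_ge0// ltW.
have /(LipP _ L0)/(_ unit_itv0 unit_itv1) := fL.
by rewrite f0 f1 mdist_unit_itvE/= subr0 normr1 mulr1.
Qed.

Let mdist_positivity x y : intrinsic_mdist x y = 0 -> x = y.
Proof.
move=> xy0; apply: (@mdist_positivity R X); apply/eqP.
by rewrite eq_le metric_structure.mdist_ge0 andbT -xy0 mdist_le_intrinsic.
Qed.

HB.instance Definition _ := Choice.copy (intrinsic_space cX) X.
HB.instance Definition _ := @isMetric.Build R (intrinsic_space cX)
  (@intrinsic_mdist R X) mdistxx mdist_positivity mdist_sym mdist_triangle.

End intrinsic_metric.

(* Main.v *)
Require Import Defs.
From HB Require Import structures.
From mathcomp Require Import all_boot all_order all_algebra.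
From mathcomp Require Import all_classical all_reals all_analysis.
From mathcomp Require Import lra ring zify.

(** If Z is injective, a complete R-tree or Urysohn, then Z is complete and
    geodesic; pushing geodesics of Z forward along a Lipschitz surjection Z -> X
    shows that X is Lipschitz connected and that the map remains Lipschitz for
    the intrinsic metric of X.

    Conversely, let (x_n) be dense in X for the intrinsic metric and let
    f : P -> X be a continuous surjection from a Polish space with dense sequence
    (e_n). Consider the rooted tree branching over pairs (x, e), with edges of
    length 2^-n at level n >= 1. A branch prescribes intrinsically short jumps between
    the x's, which are realized by Lipschitz arcs; jumps are accepted only if x
    stays close to a value of f near e and if the e's form a Cauchy sequence, so
    that every branch converges in X although X need not be complete for the
    intrinsic metric. This gives a 1-Lipschitz surjection from a separable tree T
    onto X. The tree is injective: a 1-Lipschitz map g into T is extended to a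
    point a by the upper end of the chain of the points of [root, g b] at height
    |g b| - d(a, b). Finally T embeds isometrically into a Urysohn space, built
    by adding points with prescribed distances one at a time, and T is a
    1-Lipschitz retract of it by injectivity. *)

Set Implicit Arguments.
Unset Strict Implicit.
Unset Printing Implicit Defensive.

Import Order.TTheory GRing.Theory Num.Theory.
Import metricType_numDomainType.

Local Open Scope classical_set_scope.
Local Open Scope ring_scope.

(** * Powers of one half *)

Section halves.
Context {R : realType}.

Definition half_pow (n : nat) : R := 2^-1 ^+ n.

Lemma half_pow_gt0 n : 0 < half_pow n.
Proof. by rewrite exprn_gt0// invr_gt0. Qed.

Lemma half_pow_ge0 n : 0 <= half_pow n.
Proof. exact/ltW/half_pow_gt0. Qed.

Lemma half_pow0 : half_pow 0 = 1.
Proof. by rewrite /half_pow expr0. Qed.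

Lemma half_powS n : half_pow n = 2 * half_pow n.+1.
Proof. by rewrite /half_pow exprS; lra. Qed.

Lemma half_pow_le m n : (m <= n)%N -> half_pow n <= half_pow m.
Proof.
move=> /subnK <-; elim: (n - m)%N => [|k IH]; first by rewrite add0n.
rewrite addSn; apply: le_trans IH; rewrite (half_powS (k + m)).
by have := half_pow_gt0 (k + m).+1; lra.
Qed.

Lemma half_pow_le1 n : half_pow n <= 1.
Proof. by rewrite -half_pow0 half_pow_le. Qed.

Lemma half_pow_small (e : R) : 0 < e -> exists n, half_pow n < e.
Proof.
move=> e0.
have h : forall n, n%:R * half_pow n <= 1.
  elim=> [|n IH]; first by rewrite mul0r.
  have := half_pow_le1 n; have := half_powS n; rewrite -natr1.
  move=> nE; rewrite nE in IH *; rewrite mulrDl mul1r.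
  have : n%:R * (2 * half_pow n.+1) = 2 * (n%:R * half_pow n.+1) by ring.
  by lra.
have [n ne] : exists n : nat, e^-1 < n%:R.
  exists (Num.truncn e^-1).+1; exact: truncnS_gt.
exists n; have := h n.
have := half_pow_gt0 n; have n0 : 0 < e^-1 by rewrite invr_gt0.
move=> p0 hn.
have : e^-1 * half_pow n < 1.
  by apply: lt_le_trans hn; rewrite ltr_pM2r.
by rewrite mulrC ltr_pdivrMr// mul1r.
Qed.

End halves.

(** * Density, separability and completeness in terms of sequences *)

Section metric_basics.
Context {R : realType}.
Implicit Types X Y : metricType R.

Lemma lipschitz_with1P X Y (f : X -> Y) :
  lipschitz_with 1 f <-> forall x x', mdist (f x) (f x') <= mdist x x'.
Proof.
rewrite /lipschitz_with LipP//.
by split=> h x x'; have := h x x'; rewrite mul1r.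
Qed.

Lemma lipschitz_mapP X Y (f : X -> Y) :
  lipschitz_map f <-> exists2 L : R, 0 <= L &
    forall x x', mdist (f x) (f x') <= L * mdist x x'.
Proof.
split=> [fL|[L L0 fL]]; last first.
  by rewrite /lipschitz_map (@le_lt_trans _ _ L%:E) ?ltry//; apply/LipP.
have fin : Lip f \is a fin_num by rewrite ge0_fin_numE// Lip_ge0.
exists (fine (Lip f)); first by rewrite fine_ge0// Lip_ge0.
by apply/LipP; rewrite ?fine_ge0 ?Lip_ge0// fineK.
Qed.

Lemma eq_of_mdist_le X (x y : X) :
  (forall e : R, 0 < e -> mdist x y <= e) -> x = y.
Proof.
move=> h; apply: mdist_positivity; apply/eqP; rewrite eq_le mdist_ge0 andbT.
by apply/ler_addgt0Pl => e e0; rewrite addr0 h.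
Qed.

Lemma mdist_dist_le X (x y z : X) : `|mdist x z - mdist y z| <= mdist x y.
Proof.
have := metric_triangle x y z; have := metric_triangle y x z.
by rewrite (metric_sym y x) ler_norml; lra.
Qed.

Lemma denseP X (D : set X) :
  dense D <-> forall x (e : R), 0 < e -> exists2 d, D d & mdist x d < e.
Proof.
split=> [dD x e e0|h O [x Ox] oO].
  have [||d [/= xd Dd]] := dD (ball x e)^°.
  - exists x; apply: nbhs_singleton; apply: nbhs_interior.
    exact: nbhsx_ballx.
  - exact: open_interior.
  exists d => //; have := interior_subset xd.
  by rewrite ballEmdist.
have : nbhs x O by apply: open_nbhs_nbhs.
rewrite -nbhs_ballE => -[e /= e0 xO].
by have [d Dd xd] := h x e e0; exists d; split => //; apply: xO; rewrite ballEmdist.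
Qed.

Lemma separableP X : [set: X] !=set0 ->
  separable X <-> exists u : nat -> X,
    forall x (e : R), 0 < e -> exists n, mdist x (u n) < e.
Proof.
move=> [x0 _]; split=> [[D cD /denseP dD]|[u hu]].
  have [d0 Dd0 _] := dD x0 1 ltr01.
  have [u uD] : exists u : nat -> X, D `<=` range u.
    have /pfcard_geP[D0|[g]] := cD; first by rewrite D0 in Dd0.
    by exists g; move=> x /(@surj _ _ _ _ g)[n _ <-]; exists n.
  exists u => x e /(dD x)[d /uD[n _ <-] xn]; by exists n.
exists (range u); first exact: card_image_le.
have h x (e : R) : 0 < e -> exists2 d, range u d & mdist x d < e.
  by move=> /(hu x)[n xn]; exists (u n) => //; exists n.
exact ((denseP _).2 h).
Qed.

Lemma near_mdistP X (x : X) (A : set X) :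
  nbhs x A <-> exists2 e : R, 0 < e & forall y, mdist x y < e -> A y.
Proof.
rewrite -nbhs_ballE; split=> -[e /= e0 h]; exists e => //.
  by move=> y xy; apply: h; rewrite ballEmdist.
by move=> y; rewrite ballEmdist; apply: h.
Qed.

(** The bound is [C] times the sum of [half_pow k] over [m <= k < n]. *)
Lemma geometric_mdist X (u : nat -> X) (C : R) :
  (forall n, mdist (u n) (u n.+1) <= C * half_pow n) ->
  forall m n, (m <= n)%N ->
  mdist (u m) (u n) <= C * (2 * half_pow m - 2 * half_pow n).
Proof.
move=> hu m n /subnKC <-; elim: (n - m)%N => [|k IH].
  by rewrite addn0 mdistxx subrr mulr0.
rewrite addnS; apply: le_trans (metric_triangle _ (u (m + k)%N) _) _.
have := hu (m + k)%N; move: IH; rewrite (half_powS (m + k)); lra.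
Qed.

(** A Cauchy filter is traced by centres of balls of radius [half_pow n.+2] in it. Any two such
    balls meet, so consecutive centres are less than [half_pow n] apart, and their limit is the
    limit of the filter. *)
Lemma complete_spaceP X : complete_space X <->
  forall u : nat -> X, (forall n, mdist (u n) (u n.+1) <= half_pow n) ->
    exists l, forall n, mdist (u n) l <= 2 * half_pow n.
Proof.
split=> [cX u hu|hX F FF].
have hmn m n : (m <= n)%N -> mdist (u m) (u n) <= 2 * half_pow m - 2 * half_pow n.
    move=> mn; rewrite -[leRHS]mul1r; apply: geometric_mdist => // k.
    by rewrite mul1r.
  have [|l ul] := cX (u @ \oo).
    apply/cauchyP => _/posnumP[e].
    have [N Ne] := @half_pow_small R (e%:num / 2) ltac:(by rewrite divr_gt0).
    exists (u N); exists N => // n /= Nn; rewrite ballEmdist/=.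
    apply: le_lt_trans (hmn _ _ Nn) _.
    by have := @half_pow_gt0 R n; lra.
  exists l => n; apply/ler_addgt0Pl => e e0.
  have /cvgrPdist_lt/(_ e e0)[N _ hN] := ul.
  have /= := hN (maxn N n) (leq_maxl _ _).
  have := hmn n (maxn N n) (leq_maxr _ _).
  have := @half_pow_gt0 R (maxn N n).
  have := metric_triangle (u n) (u (maxn N n)) l.
  by rewrite (metric_sym l); lra.
move=> /cauchyP cF.
have /choice[u hu] : forall n, exists x, F (ball x (half_pow n.+2 : R)).
  by move=> n; apply: cF; exact: half_pow_gt0.
have [n|l hl] := hX u.
  have [z [/=]] := filter_ex (filterI (hu n) (hu n.+1)).
  rewrite !ballEmdist/= => h1 h2.
  have := metric_triangle (u n) z (u n.+1); rewrite (metric_sym z).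
  have := @half_powS R n; have := @half_powS R n.+1; have := @half_powS R n.+2.
  have := @half_pow_gt0 R n.+3; lra.
exists l => A /near_mdistP[e e0 hA].
have [n ne] := @half_pow_small R (e / 3) ltac:(by rewrite divr_gt0).
apply: filterS (hu n) => y; rewrite ballEmdist/= => uy; apply: hA.
have := metric_triangle l (u n) y; rewrite (metric_sym l (u n)).
have := @half_powS R n; have := @half_powS R n.+1; have := hl n.
have := @half_pow_gt0 R n.+2; lra.
Qed.

End metric_basics.

Lemma complete_real (R : realType) : complete_space (R^o : metricType R).
Proof. by move=> F FF cF; exists (lim F); exact: cauchy_cvg. Qed.

(** * Completion of a pseudometric space *)

Record pseudometric (R : realType) (Q : Type) := Pseudometric {
  pdist :> Q -> Q -> R ;
  pdistxx : forall x, pdist x x = 0 ;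
  pdist_sym : forall x y, pdist x y = pdist y x ;
  pdist_triangle : forall y x z, pdist x z <= pdist x y + pdist y z
}.

Section completion.
Context {R : realType} {Q : Type}.

Lemma pdist_dist_le (d : pseudometric R Q) x y z : `|d x z - d y z| <= d x y.
Proof.
have := pdist_triangle d x y z; have := pdist_triangle d y x z.
by rewrite (pdist_sym _ y x) ler_norml; lra.
Qed.

(* A point of the completion is represented by its distance function to the
   points of [Q], a uniform limit of functions [d z]. *)
Record completion (d : pseudometric R Q) := Completion {
  cfun : Q -> R ;
  cfunP : forall e : R, 0 < e -> exists z, forall w, `|cfun w - d z w| <= e
}.

Variable d : pseudometric R Q.
Implicit Types u v : completion d.

HB.instance Definition _ := gen_eqMixin (completion d).
HB.instance Definition _ := gen_choiceMixin (completion d).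

Lemma cfun_inj u v : cfun u = cfun v -> u = v.
Proof.
by case: u v => [f hf] [g hg] /= E; move: hg; rewrite -E => hg; congr Completion.
Qed.

Let diffs u v := [set `|cfun u w - cfun v w| | w in [set: Q]].

Definition cdist u v : R := sup (diffs u v).

Let diffs_ub u v : has_ubound (diffs u v).
Proof.
have [z hz] := cfunP u ltr01; have [z' hz'] := cfunP v ltr01.
exists (2 + d z z') => _ [w _ <-].
have := hz w; have := hz' w; have := pdist_dist_le d z z' w.
by rewrite !ler_norml; lra.
Qed.

Lemma cfun_dist_le u v w : `|cfun u w - cfun v w| <= cdist u v.
Proof. by apply: ub_le_sup => //; exists w. Qed.

Lemma cdist_le u v (c : R) :
  (forall w, `|cfun u w - cfun v w| <= c) -> cdist u v <= c.
Proof.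
move=> h; apply: ge_sup => [|_ [w _ <-]]; last exact: h.
by have [z _] := cfunP u ltr01; exists `|cfun u z - cfun v z|; exists z.
Qed.

Let cdistxx u : cdist u u = 0.
Proof.
have [z _] := cfunP u ltr01; apply/eqP; rewrite eq_le; apply/andP; split.
  by apply: cdist_le => w; rewrite subrr normr0.
by apply: le_trans (cfun_dist_le u u z).
Qed.

Let cdist_positivity u v : cdist u v = 0 -> u = v.
Proof.
move=> uv0; apply: cfun_inj; apply/funext => w; apply/eqP.
by rewrite -subr_eq0 -normr_le0 -uv0 cfun_dist_le.
Qed.

Let cdist_sym u v : cdist u v = cdist v u.
Proof.
by rewrite /cdist /diffs; under eq_imagel do rewrite distrC.
Qed.

Let cdist_triangle v u w : cdist u w <= cdist u v + cdist v w.
Proof.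
apply: cdist_le => z; apply: le_trans (ler_distD (cfun v z) _ _) _.
by rewrite lerD ?cfun_dist_le.
Qed.

HB.instance Definition _ := @isMetric.Build R (completion d) cdist
  cdistxx cdist_positivity cdist_sym cdist_triangle.

Let in_completion_subproof (z : Q) (e : R) : 0 < e ->
  exists z', forall w, `|d z w - d z' w| <= e.
Proof. by move=> e0; exists z => w; rewrite subrr normr0 ltW. Qed.

Definition in_completion (z : Q) : completion d :=
  Completion (in_completion_subproof z).

Lemma mdist_completionE u v : mdist u v = cdist u v.
Proof. by []. Qed.

(** As in the Kuratowski embedding, the supremum is attained at [w = z], where [d z z] vanishes; the
    other bound is the triangle inequality passed to a uniform limit. *)
Lemma mdist_in_completionr u z : mdist u (in_completion z) = cfun u z.
Proof.
rewrite mdist_completionE; apply/eqP; rewrite eq_le; apply/andP; split.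
  apply: cdist_le => w /=; apply/ler_addgt0Pl => e e0.
  have [z' hz'] := cfunP u (ltac:(lra) : 0 < e / 2).
  have := hz' w; have := hz' z; have := pdist_dist_le d z' z w.
  by rewrite (pdist_sym d z' z) !ler_norml; lra.
have := cfun_dist_le u (in_completion z) z; rewrite /= pdistxx subr0.
exact: le_trans (ler_norm _).
Qed.

Lemma mdist_in_completion y z :
  mdist (in_completion y) (in_completion z) = d y z.
Proof. exact: mdist_in_completionr. Qed.

Lemma in_completion_dense u (e : R) : 0 < e ->
  exists z, mdist u (in_completion z) < e.
Proof.
move=> e0; have [z hz] := cfunP u (ltac:(lra) : 0 < e / 2).
exists z; apply: (@le_lt_trans _ _ (e / 2)); last lra.
by rewrite mdist_completionE; exact: cdist_le.
Qed.

(** Pointwise limits exist in the reals at a rate independent of the point, so the limit function is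
    again uniformly approximated by functions [d z]. *)
Lemma completion_complete : complete_space (completion d).
Proof.
apply/complete_spaceP => c hc.
have hw w : exists l : R^o, forall n, `|l - cfun (c n) w| <= 2 * half_pow n.
  have /complete_spaceP hR := @complete_real R.
  apply: (hR (fun n => cfun (c n) w)) => n; rewrite [leLHS]distrC.
  by apply: le_trans (hc n); exact: cfun_dist_le.
have [l hl] := choice hw.
have lP (e : R) : 0 < e -> exists z, forall w, `|l w - d z w| <= e.
  move=> e0; have [n ne] := @half_pow_small R (e / 4) ltac:(lra).
  have [z hz] := cfunP (c n) (ltac:(lra) : 0 < e / 2).
  by exists z => w; have := hz w; have := hl w n; rewrite !ler_norml; lra.
exists (Completion lP) => n; rewrite mdist_completionE.
by apply: cdist_le => w /=; rewrite distrC.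
Qed.

End completion.

(** * Geodesic and injective spaces *)

Section sequences.
Context {R : realType} {X : metricType R}.
Implicit Types (u v : nat -> X) (l : X).

Lemma cvg_mdistP u l : u @ \oo --> l <->
  forall e : R, 0 < e -> exists N, forall n, (N <= n)%N -> mdist (u n) l < e.
Proof.
split=> [/cvgrPdist_lt ul e /ul[N _ hN]|h].
  by exists N => n Nn; rewrite metric_sym; exact: hN.
apply/cvgrPdist_lt => e /h[N hN]; exists N => // n /= Nn.
by rewrite metric_sym; exact: hN.
Qed.

Lemma lim_mdist_le u v l l' (c : R) : u @ \oo --> l -> v @ \oo --> l' ->
  (forall e : R, 0 < e ->
    exists N, forall n, (N <= n)%N -> mdist (u n) (v n) <= c + e) ->
  mdist l l' <= c.
Proof.
move=> /cvg_mdistP ul /cvg_mdistP vl h; apply/ler_addgt0Pl => e e0.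
have e3 : 0 < e / 3 by lra.
have [N1 h1] := ul _ e3; have [N2 h2] := vl _ e3; have [N3 h3] := h _ e3.
pose n := maxn N1 (maxn N2 N3).
have := h1 n (leq_maxl _ _).
have := h2 n (leq_trans (leq_maxl _ _) (leq_maxr _ _)).
have := h3 n (leq_trans (leq_maxr _ _) (leq_maxr _ _)).
have := metric_triangle l (u n) l'; have := metric_triangle (u n) (v n) l'.
by rewrite (metric_sym l (u n)); lra.
Qed.

Lemma cauchy_seq_cvg u : complete_space X ->
  (forall e : R, 0 < e -> exists N, forall m n, (N <= m)%N -> (m <= n)%N ->
     mdist (u m) (u n) <= e) ->
  exists l, u @ \oo --> l.
Proof.
move=> cX hu; have [|l ul] := cX (u @ \oo); last by exists l.
apply/cauchyP => _/posnumP[e].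
have [N hN] := hu (e%:num / 2) ltac:(by rewrite divr_gt0).
exists (u N); exists N => // n /= Nn; rewrite ballEmdist/=.
have e0 : 0 < e%:num by [].
by apply: le_lt_trans (hN N n _ _) _ => //; lra.
Qed.

Lemma geometric_cvg u (C : R) : complete_space X -> 0 <= C ->
  (forall n, mdist (u n) (u n.+1) <= C * half_pow n) -> exists l, u @ \oo --> l.
Proof.
move=> cX C0 hu; apply: cauchy_seq_cvg => // e e0.
have [N hN] := @half_pow_small R (e / (2 * C + 1))
  ltac:(by rewrite divr_gt0//; lra).
exists N => m n Nm mn; apply: le_trans (geometric_mdist hu mn) _.
rewrite ltr_pdivlMr in hN; last lra.
have := half_pow_le (R := R) Nm; have := @half_pow_gt0 R n.
move: (half_pow n) (half_pow m) (half_pow N) hN => a b c hN a0 bc; nra.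
Qed.

End sequences.

Section extension.
Context {R : realType}.
Implicit Types X Z A : metricType R.

(** The partial map is indexed by any type, which avoids building subspaces. The map [i] need not be
    injective: the hypothesis makes [f] constant on its fibres. *)
Lemma injective_extend Z A (T : Type) (i : T -> A) (f : T -> Z) :
  injective_space Z -> (forall t t', mdist (f t) (f t') <= mdist (i t) (i t')) ->
  exists g : A -> Z,
    (forall a a', mdist (g a) (g a') <= mdist a a') /\ forall t, g (i t) = f t.
Proof.
move=> injZ fi.
have hT (b : range i) : exists t, i t = set_val b.
  by have [t _ tb] := set_valP b; exists t.
have [s hs] := choice hT.
have [|g [/lipschitz_with1P g1 gf]] := injZ A (range i) (f \o s).
  by apply/lipschitz_with1P => b b' /=; apply: le_trans (fi _ _) _; rewrite !hs.
exists g; split => // t.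
have rt : i t \in range i by apply/mem_set; exists t.
have -> : i t = set_val (SigSub rt : range i) by [].
rewrite gf /=; apply: mdist_positivity; apply/eqP.
rewrite eq_le mdist_ge0 andbT; apply: le_trans (fi _ _) _.
by rewrite hs/= mdistxx.
Qed.

Lemma injective_retract Z A (i : Z -> A) : injective_space Z ->
  isometric_embedding i ->
  exists r : A -> Z,
    (forall a a', mdist (r a) (r a') <= mdist a a') /\ cancel i r.
Proof.
move=> injZ isoi; apply: (@injective_extend Z A Z i id) => //= t t'.
by rewrite isoi.
Qed.

(** The empty map into [Z] extends to the real line. *)
Lemma injective_neq0 Z : injective_space Z -> [set: Z] !=set0.
Proof.
move=> injZ.
have [|g _] := @injective_extend Z R^o False (fun x => match x with end)
  (fun x => match x with end) injZ; first by case.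
by exists (g 0).
Qed.

Program Definition metric_pseudometric X : pseudometric R X :=
  @Pseudometric R X (@mdist R X) _ _ _.
Next Obligation. by move=> *; exact: mdistxx. Qed.
Next Obligation. by move=> *; exact: metric_sym. Qed.
Next Obligation. by move=> *; exact: metric_triangle. Qed.

(** [Z] is a 1-Lipschitz retract of its completion, and the retraction sends limits in the
    completion to limits in [Z]. *)
Lemma injective_complete Z : injective_space Z -> complete_space Z.
Proof.
move=> injZ; pose i := in_completion (metric_pseudometric Z).
have isoi : isometric_embedding i by move=> x y; rewrite mdist_in_completion.
have [r [r1 rK]] := injective_retract injZ isoi.
have /complete_spaceP cC := @completion_complete _ _ (metric_pseudometric Z).
apply/complete_spaceP => u hu.
have [|l hl] := cC (i \o u); first by move=> n /=; rewrite isoi.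
exists (r l) => n; rewrite -(rK (u n)); apply: le_trans (r1 _ _) _; exact: hl.
Qed.

(** A 1-Lipschitz bound suffices: with the two end values it forces [g] to be isometric on the
    interval from 0 to [mdist x y]. Taking all of [R] as domain avoids a subtype. *)
Definition geodesic_space X := forall x y : X, exists g : R -> X,
  [/\ forall s t, mdist (g s) (g t) <= `|s - t|, g 0 = x & g (mdist x y) = y].

(** The map from the two points 0 and [mdist x y] of the line to [x] and [y] is extended to the
    whole line. *)
Lemma injective_geodesic Z : injective_space Z -> geodesic_space Z.
Proof.
move=> injZ x y.
pose i (b : bool) : R^o := if b then mdist x y else 0.
have [|g [g1 gi]] := @injective_extend Z R^o bool i
  (fun b => if b then y else x) injZ.
  have E a b : @mdist R R^o a b = `|b - a| by [].
  case=> [] []; rewrite E /i ?mdistxx// ?subr0 ?sub0r ?normrN.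
    by rewrite (ger0_norm (mdist_ge0 _ _)) // metric_sym.
  by rewrite (ger0_norm (mdist_ge0 _ _)).
exists g; split; [|exact: (gi false)|exact: (gi true)].
by move=> s t; rewrite distrC; exact: g1.
Qed.

Lemma unit_itv_clamp_le (a b : R) : a <= b ->
  0 <= unit_itv_clamp a <= unit_itv_clamp b /\
  unit_itv_clamp b - unit_itv_clamp a <= b - a.
Proof.
rewrite /unit_itv_clamp => ab; case: (leP a 1) => a1; case: (leP b 1) => b1;
  case: (leP 0 a) => a0; case: (leP 0 b) => b0;
  rewrite ?(max_r (@ler01 R)); split; lra.
Qed.

Section midpoints.
Variables (X : metricType R) (cX : complete_space X).
Hypothesis midX : forall x y : X,
  exists m, mdist x m <= mdist x y / 2 /\ mdist m y <= mdist x y / 2.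

Let mid_choice : exists m : X -> X -> X, forall x y,
  mdist x (m x y) <= mdist x y / 2 /\ mdist (m x y) y <= mdist x y / 2.
Proof.
have [m hm] := choice (fun p : X * X => midX p.1 p.2).
by exists (fun x y => m (x, y)) => x y; exact: (hm (x, y)).
Qed.

(** Repeated bisection places points at the dyadic parameters of the unit interval; completeness
    fills in the rest, and a rescaling by [D] gives the geodesic. *)
Lemma midpoints_geodesic : geodesic_space X.
Proof.
move=> x y; have [m hm] := mid_choice.
have := mdist_ge0 x y; rewrite le_eqVlt => /predU1P[xy0|D0].
  exists (fun=> x); split => // [s t|]; first by rewrite mdistxx.
  by apply: mdist_positivity.
set D := mdist x y in D0 *.
(* [P n k] is the point at parameter [k / 2 ^ n]. It stays at [y] beyond parameter 1, so the step
   bound holds for every [k]. *)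
pose P := fix P n (k : nat) : X := if n is n'.+1 then
    if odd k then m (P n' k./2) (P n' k./2.+1) else P n' k./2
  else if k is 0%N then x else y.
have Pstep n k : mdist (P n k) (P n k.+1) <= D * half_pow n.
  elim: n k => [|n IH] k.
    by rewrite half_pow0 mulr1; case: k => [|k] //=; rewrite mdistxx ltW.
  have [h1 h2] := hm (P n k./2) (P n k./2.+1); have := IH k./2.
  rewrite half_powS /= uphalf_half; case: (odd k) => /= {}IH.
    by rewrite add1n; lra.
  by rewrite add0n; lra.
have Pdist n j k : (j <= k)%N ->
    mdist (P n j) (P n k) <= D * half_pow n * (k%:R - j%:R).
  move=> /subnKC <-; elim: (k - j)%N => [|i IH].
    by rewrite addn0 mdistxx subrr mulr0.
  rewrite addnS; apply: le_trans (metric_triangle _ (P n (j + i)%N) _) _.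
  have := Pstep n (j + i)%N; move: IH; rewrite -natr1; lra.
pose idx n (t : R) := Num.truncn (t / half_pow n).
have idxP n t : 0 <= t ->
    (idx n t)%:R * half_pow n <= t < (idx n t)%:R * half_pow n + half_pow n.
  move=> t0; have h0 := @half_pow_gt0 R n.
  have /truncn_itv/andP[h1 h2] : 0 <= t / half_pow n by rewrite divr_ge0// ltW.
  apply/andP; split; first by rewrite -ler_pdivlMr.
  by move: h2; rewrite ltr_pdivrMr// -natr1 mulrDl mul1r.
pose u t n := P n (idx n t).
(* From level [n] to [n.+1] the approximant of [t] either stays or moves to the midpoint of its
   dyadic cell. *)
have ustep t n : 0 <= t -> mdist (u t n) (u t n.+1) <= D * half_pow n.
  move=> t0.
  have : (idx n.+1 t = (idx n t).*2 \/ idx n.+1 t = (idx n t).*2.+1)%N.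
    have /andP[a1 a2] := idxP n t t0; have /andP[b1 b2] := idxP n.+1 t t0.
    have h0 := @half_pow_gt0 R n.+1.
    rewrite (half_powS n) in a1 a2.
    have c1 : ((idx n t).*2 < (idx n.+1 t).+1)%N.
      rewrite -(ltr_nat R) -(ltr_pM2r h0) -natr1 -muln2 natrM; lra.
    have c2 : (idx n.+1 t < (idx n t).*2.+2)%N.
      rewrite -(ltr_nat R) -(ltr_pM2r h0) -natr1 -natr1 -muln2 natrM; lra.
    by move: (idx n.+1 t) (idx n t) c1 c2 => a b; clear; lia.
  case=> E; rewrite /u E /=.
    by rewrite odd_double doubleK mdistxx mulr_ge0 ?half_pow_ge0// ltW.
  rewrite odd_double/= uphalf_double.
  have [h1 _] := hm (P n (idx n t)) (P n (idx n t).+1).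
  have := Pstep n (idx n t).
  have := mdist_ge0 (P n (idx n t)) (P n (idx n t).+1); lra.
(* Rounding down to the dyadic grid costs at most one cell, hence the extra term, which vanishes in
   the limit. *)
have uL s t n : 0 <= s <= t ->
    mdist (u s n) (u t n) <= D * (t - s) + D * half_pow n.
  move=> /andP[s0 st]; have t0 := le_trans s0 st.
  have /andP[a1 a2] := idxP n s s0; have /andP[b1 b2] := idxP n t t0.
  have : (idx n s <= idx n t)%N.
    have h0 := @half_pow_gt0 R n.
    rewrite -ltnS -(ltr_nat R) -(ltr_pM2r h0) -natr1; lra.
  move=> /(Pdist n) /le_trans; apply.
  rewrite -mulrA -mulrDr ler_pM2l//; lra.
have hl (t : R) : exists l : X, 0 <= t -> u t @ \oo --> l.
  have [t0|t0] := leP 0 t; last by exists x; lra.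
  have [l ul] := geometric_cvg cX (ltW D0) (fun n => ustep t n t0).
  by exists l.
have [l ul] := choice hl.
have lL s t : 0 <= s <= t -> mdist (l s) (l t) <= D * (t - s).
  move=> st; have /andP[s0 st'] := st.
  apply: (lim_mdist_le (ul s s0) (ul t (le_trans s0 st'))) => e e0.
  have [N hN] := @half_pow_small R (e / D) ltac:(by rewrite divr_gt0).
  exists N => n Nn; apply: le_trans (uL s t n st) _; rewrite lerD2l.
  rewrite ltr_pdivlMr// mulrC in hN; apply: le_trans (ltW hN).
  by rewrite ler_pM2l// half_pow_le.
have ux n : u 0 n = x.
  have -> : u 0 n = P n 0%N by rewrite /u /idx mul0r truncn0.
  by elim: n.
have uy n : u 1 n = y.
  have -> : u 1 n = P n (2 ^ n)%N.
    by rewrite /u /idx mul1r /half_pow exprVn invrK -natrX natrK.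
  elim: n => [//|n IH] /=.
  by rewrite expnS mul2n odd_double doubleK.
exists (fun t => l (val (to_unit_itv (t / D)))); split.
- move=> s t.
  wlog st : s t / s <= t.
    move=> h; have [/h//|/ltW/h] := leP s t.
    by rewrite metric_sym distrC.
  have stD : s / D <= t / D by rewrite ler_pM2r// invr_gt0.
  have [h1 h2] := unit_itv_clamp_le stD.
  apply: le_trans (lL _ _ h1) _; rewrite ler0_norm; last lra.
  have -> : - (s - t) = D * (t / D - s / D).
    by rewrite -mulrBl mulrC divfK ?gt_eqF//; lra.
  by rewrite ler_pM2l.
- rewrite mul0r to_unit_itv0; apply: eq_of_mdist_le => e e0.
  have [N /(_ N (leqnn N))] := (cvg_mdistP _ _).1 (ul 0 (lexx _)) e e0.
  by rewrite ux metric_sym => /ltW.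
- rewrite divff ?gt_eqF// to_unit_itv1; apply: eq_of_mdist_le => e e0.
  have [N /(_ N (leqnn N))] := (cvg_mdistP _ _).1 (ul 1 ler01) e e0.
  by rewrite uy metric_sym => /ltW.
Qed.
End midpoints.
End extension.

(** * Lipschitz images of geodesic spaces *)

Section intrinsic.
Context {R : realType} {X : metricType R} (cX : lipschitz_connected X).

Lemma intrinsic_edist_fin_num (x y : X) : intrinsic_edist x y \is a fin_num.
Proof.
have e0 : (0 <= intrinsic_edist x y)%E.
  by apply: le_ereal_inf_tmp => _ [f _ <-]; exact: Lip_ge0.
rewrite ge0_fin_numE//; have [f fL fxy] := cX x y.
by apply: le_lt_trans fL; apply: ereal_inf_lbound; exists f.
Qed.

Lemma intrinsic_mdist_path (x y : X) (L : R) : intrinsic_mdist x y < L ->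
  exists2 f, path_from_to x y f & (Lip f <= L%:E)%E.
Proof.
rewrite -lte_fin fineK ?intrinsic_edist_fin_num//.
by move=> /ereal_inf_lt[_ [f fxy <-]] /ltW fL; exists f.
Qed.

Lemma intrinsic_mdist_le (x y : X) f (L : R) :
  path_from_to x y f -> (Lip f <= L%:E)%E -> intrinsic_mdist x y <= L.
Proof.
move=> fxy fL; rewrite -lee_fin fineK ?intrinsic_edist_fin_num//.
by apply: le_trans fL; apply: ereal_inf_lbound; exists f.
Qed.

End intrinsic.

Section geodesic_images.
Context {R : realType}.
Implicit Types X Z : metricType R.

Lemma lipschitz_continuous Z X (f : Z -> X) : lipschitz_map f -> continuous f.
Proof.
move=> /lipschitz_mapP[L L0 fL] x A /near_mdistP[e e0 hA].
(* Dividing by [L + 1] covers the case [L = 0]. *)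
apply/near_mdistP; exists (e / (L + 1)); first by rewrite divr_gt0//; lra.
move=> y; rewrite ltr_pdivlMr; last lra.
move=> xy; apply: hA; apply: le_lt_trans (fL _ _) _.
by apply: le_lt_trans xy; rewrite mulrC ler_wpM2l// ?mdist_ge0//; lra.
Qed.

Lemma geodesic_image_path Z X (f : Z -> X) (L : R) (z z' : Z) : 0 <= L ->
  (forall a b, mdist (f a) (f b) <= L * mdist a b) -> geodesic_space Z ->
  exists2 p, path_from_to (f z) (f z') p & (Lip p <= (L * mdist z z')%:E)%E.
Proof.
move=> L0 fL gZ; have [g [g1 g0 gD]] := gZ z z'.
exists (fun t => f (g (mdist z z' * val t))).
  by split => /=; rewrite ?mulr0 ?mulr1 ?g0 ?gD.
apply/LipP => [|s t]; first by rewrite mulr_ge0// mdist_ge0.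
apply: le_trans (fL _ _) _; rewrite -mulrA ler_wpM2l//.
apply: le_trans (g1 _ _) _.
by rewrite -mulrBr normrM (ger0_norm (mdist_ge0 _ _)) distrC.
Qed.

(** Geodesics pushed forward by [f] bound the intrinsic distance of [f z] and [f z'] by
    [L * mdist z z'], so the image of a dense set is dense for the intrinsic metric too. *)
Lemma geodesic_image Z X : separable Z -> complete_space Z -> geodesic_space Z ->
  lipschitz_image_of X Z ->
  [/\ analytic R X, lipschitz_connected X
    & exists cX : lipschitz_connected X, separable (intrinsic_space cX)].
Proof.
move=> sZ cZ gZ [f [fsurj fLip]].
have fS x : exists z, f z = x.
  have : [set: X] x by [].
  by rewrite -fsurj => -[z _ <-]; exists z.
have /lipschitz_mapP[L L0 fL] := fLip.
have cX : lipschitz_connected X.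
  move=> x y; have [z <-] := fS x; have [z' <-] := fS y.
  have [p pzz' pL] := geodesic_image_path z z' L0 fL gZ.
  by exists p => //; exact: le_lt_trans pL (ltry _).
split=> //.
  by exists Z; split=> //; exists f; split=> //; exact: lipschitz_continuous.
exists cX; have [D cD /denseP dD] := sZ.
exists (f @` D); first exact: card_le_trans (card_image_le _ _) cD.
have h (x : intrinsic_space cX) (e : R) :
    0 < e -> exists2 d, (f @` D) d & mdist x d < e.
  move=> e0; have [z zx] := fS x.
  have [d Dd zd] := dD z (e / (L + 1)) ltac:(by rewrite divr_gt0//; lra).
  exists (f d); first by exists d.
  have [p pzd pL] := geodesic_image_path z d L0 fL gZ.
  rewrite -zx; apply: le_lt_trans (intrinsic_mdist_le cX pzd pL) _.
  move: zd; rewrite ltr_pdivlMr; last lra.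
  by apply: le_lt_trans; rewrite mulrC ler_wpM2l// ?mdist_ge0//; lra.
exact ((denseP _).2 h).
Qed.

(** The geodesic is the inverse of the isometry [phi], precomposed with the clamping [c] so that it
    is defined on all of [R]. *)
Lemma R_tree_geodesic X : R_tree X -> geodesic_space X.
Proof.
move=> [segX _] x y; have [phi [phi_iso phi_surj]] := segX x y.
set D := mdist x y in phi phi_iso phi_surj *.
have D0 : 0 <= D := mdist_ge0 _ _.
pose c (t : R) : R^o := Num.max 0 (Num.min t D).
have cP t : c t \in real_itv 0 D.
  apply/mem_set; rewrite /real_itv/= /c.
  by rewrite le_max lexx/= ge_max D0 ge_min lexx orbT.
have cE t : 0 <= t <= D -> c t = t.
  by move=> /andP[t0 tD]; rewrite /c min_l// max_r.
have cL s t : `|c s - c t| <= `|s - t|.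
  wlog st : s t / s <= t.
    move=> h; have [/h//|/ltW/h] := leP s t.
    by rewrite distrC (distrC t s).
  rewrite /c; case: (leP s D) => h1; case: (leP t D) => h2;
  case: (leP 0 s) => h3; case: (leP 0 t) => h4;
  rewrite ?(max_r D0) (ler0_norm (x := s - t)); try lra; rewrite ler_norml; lra.
have phiS t : exists s, phi s = t.
  have : [set: real_itv 0 D] t by [].
  by rewrite -phi_surj => -[s _ <-]; exists s.
have [psi hpsi] := choice phiS.
have psi_phi s : psi (phi s) = s.
  by apply: mdist_positivity; rewrite -phi_iso hpsi mdistxx.
have xseg : x \in segment x y by apply/mem_set; rewrite /segment/= mdistxx add0r.
have yseg : y \in segment x y by apply/mem_set; rewrite /segment/= mdistxx addr0.
pose px : segment x y := SigSub xseg; pose py : segment x y := SigSub yseg.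
have ab : `|val (phi py) - val (phi px) : R| = D.
  by have := phi_iso px py.
have /set_mem := valP (phi px); have /set_mem := valP (phi py).
rewrite /real_itv/= => bD aD.
pose G (t : R) : X := set_val (psi (SigSub (cP t))).
have G1 s t : mdist (G s) (G t) <= `|s - t|.
  have -> : mdist (G s) (G t) = `|c t - c s|.
    by rewrite -[LHS]phi_iso !hpsi.
  by rewrite distrC.
have Gx : G (val (phi px)) = x.
  rewrite /G (_ : SigSub _ = phi px) ?psi_phi//.
  by apply: val_inj => /=; rewrite cE.
have Gy : G (val (phi py)) = y.
  rewrite /G (_ : SigSub _ = phi py) ?psi_phi//.
  by apply: val_inj => /=; rewrite cE.
have {}aD : 0 <= (val (phi px) : R) <= D := aD.
have {}bD : 0 <= (val (phi py) : R) <= D := bD.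
move: ab aD bD Gx Gy; move: (val (phi px) : R) (val (phi py) : R) => a b.
move=> ab aD bD Gx Gy.
(* The images [a], [b] of [x], [y] lie at distance [D] in an interval of length [D], so they are its
   ends. Their order is unknown; in the second case the parametrization is reversed. *)
have [a0|a0] := leP a 0.
  exists G; split=> //.
  - by rewrite -[RHS]Gx; congr G; lra.
  - rewrite -[RHS]Gy; congr G; move: ab.
    by have [|] := leP 0 (b - a) => h;
      [rewrite ger0_norm|rewrite ltr0_norm] => //; lra.
exists (fun t => G (D - t)); split=> [s t| |].
- apply: le_trans (G1 _ _) _.
  by rewrite (_ : D - s - (D - t) = - (s - t)) ?normrN//; lra.
- rewrite -[RHS]Gx; congr G; move: ab.
  by have [|] := leP 0 (b - a) => h;
    [rewrite ger0_norm|rewrite ltr0_norm] => //; lra.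
- rewrite -[RHS]Gy; congr G; move: ab.
  by have [|] := leP 0 (b - a) => h;
    [rewrite ger0_norm|rewrite ltr0_norm] => //; lra.
Qed.

(** Midpoints come from extending an embedding of the points 0 and [D] to the subspace of the line
    with the further point [D / 2]. *)
Lemma urysohn_geodesic X : urysohn_space X -> geodesic_space X.
Proof.
move=> [cX _ extX]; apply: midpoints_geodesic => // x y.
set D := mdist x y; have D0 : 0 <= D := mdist_ge0 _ _.
pose S : set R^o := [set 0; D / 2; D].
have S0 : (0 : R^o) \in S by apply/mem_set; left; left.
have S1 : (D / 2 : R^o) \in S by apply/mem_set; left; right.
have S2 : (D : R^o) \in S by apply/mem_set; right.
pose b0 : S := SigSub S0; pose b1 : S := SigSub S1; pose b2 : S := SigSub S2.
have finS : finite_set [set: S].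
  have -> : [set: S] = set_val @^-1` S.
    by apply/seteqP; split=> // s _; exact: set_valP.
  apply: finite_preimage; first by move=> s t _ _; exact: val_inj.
  by rewrite /S !finite_setU; split; [split|]; exact: finite_set1.
pose A : set S := [set b0; b2].
(* If [D = 0], the points [b0] and [b2] coincide and both are sent to [x], which then equals [y]. *)
pose f (a : A) : X := if (val (val a) : R) == 0 then x else y.
have dE (s t : S) : mdist s t = `|(val t : R) - val s| by [].
have [|g [g_iso gf]] := extX S A f finS.
  move=> a a'; rewrite -[RHS]/(mdist (val a) (val a')) dE /f.
  have [E|E] : val a = b0 \/ val a = b2 by have /set_mem := valP a.
    rewrite E /= eqxx.
    have [->|->] : val a' = b0 \/ val a' = b2 by have /set_mem := valP a'.
      by rewrite /= eqxx mdistxx subrr normr0.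
    by rewrite /= subr0 ger0_norm//; case: eqP => // ->; rewrite mdistxx.
  have [E'|E'] : val a' = b0 \/ val a' = b2 by have /set_mem := valP a'.
    rewrite E E' /= eqxx sub0r normrN ger0_norm//; case: eqP => [->|_].
      by rewrite mdistxx.
    by rewrite metric_sym.
  by rewrite E E' subrr normr0 mdistxx.
have A0 : b0 \in A by apply/mem_set; left.
have A2 : b2 \in A by apply/mem_set; right.
have gx : g b0 = x by have := gf (SigSub A0); rewrite /f /= eqxx.
have gy : g b2 = y.
  have := gf (SigSub A2); rewrite /f /=; case: eqP => [D00 ->|//].
  by apply: mdist_positivity.
exists (g b1); rewrite -{1}gx -{1}gy !g_iso !dE /= subr0 ger0_norm; last lra.
by rewrite ger0_norm; lra.
Qed.

End geodesic_images.

(** * Zero-hyperbolic spaces *)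

Section hyperbolic.
Context {R : realType} (T : metricType R).

(** In a tree this is the height above [o] at which the segments to [p] and [q] separate. *)
Definition gromov (o p q : T) : R := (mdist o p + mdist o q - mdist p q) / 2.

Definition zero_hyperbolic (o : T) := forall p q r : T,
  Num.min (gromov o p q) (gromov o q r) <= gromov o p r.

Lemma gromov_sym o p q : gromov o p q = gromov o q p.
Proof. by rewrite /gromov (metric_sym p) (addrC (mdist o p)). Qed.

Lemma gromov_root o p : gromov o p o = 0.
Proof. by rewrite /gromov mdistxx (metric_sym p) addr0 subrr mul0r. Qed.

(** The four-point condition, free of the base point. In Gromov products it reads [(x|y) + (z|w) >=
    min ((x|z) + (y|w)) ((x|w) + (y|z))]. If, say, [(x|z)] is the largest product on the right, then
    [(x|y) >= (y|z)] and [(z|w) >= (x|w)]. *)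
Lemma four_points o : zero_hyperbolic o -> forall x y z w : T,
  mdist x y + mdist z w <=
  Num.max (mdist x z + mdist y w) (mdist x w + mdist y z).
Proof.
move=> H x y z w.
have := H x z y; have := H x w y; have := H z x w; have := H z y w.
rewrite !ge_min le_max (gromov_sym o z x) (gromov_sym o z y).
rewrite (gromov_sym o w y) /gromov.
move: (mdist o x) (mdist o y) (mdist o z) (mdist o w) => a b c d.
move: (mdist x y) (mdist x z) (mdist x w) => xy xz xw.
move: (mdist y z) (mdist y w) (mdist z w) => yz yw zw.
move=> /orP h1 /orP h2 /orP h3 /orP h4.
have [//|h5] := leP (xy + zw) (xz + yw); have [//|h6] := leP (xy + zw) (xw + yz).
by exfalso; case: h1 => h1; case: h2 => h2; case: h3 => h3; case: h4 => h4; lra.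
Qed.

(* The union of a family of initial segments [[o, p]] truncated at height [t]
   which are pairwise nested has an upper end point. *)
Definition rooted_chain_complete (o : T) := forall A : set (T * R),
  A (o, 0) -> (forall p t, A (p, t) -> t <= mdist o p) ->
  (forall p t p' t', A (p, t) -> A (p', t') -> Num.min t t' <= gromov o p p') ->
  has_ubound (snd @` A) ->
  exists q, mdist o q = sup (snd @` A) /\
    forall p t, A (p, t) -> t <= gromov o q p.

Section injectivity.
Variables (o : T) (hypT : zero_hyperbolic o) (chainT : rooted_chain_complete o).
Variables (A : metricType R) (B : set A) (f : B -> T).
Hypothesis f1 : forall b b', mdist (f b) (f b') <= mdist b b'.

(** A pair [(p, t)] stands for the point of the segment from [o] to [p] at height [t]. An admissible
    image of [a] must share the segment to [f b] at least up to height [mdist o (f b) - mdist a b].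
    The pair [(o, 0)] keeps the family nonempty and its supremum nonnegative. *)
Let fam (a : A) : set (T * R) := (o, 0) |`
  [set (f b, mdist o (f b) - mdist a (set_val b)) | b in [set: B]].

Let fam_le a p t : fam a (p, t) -> t <= mdist o p.
Proof.
by case=> [[-> ->]|[b _ [<- <-]]]; rewrite ?mdistxx// lerBlDr lerDl mdist_ge0.
Qed.

(** When both pairs come from [B], this is the bound on [mdist (f b) (f b')] combined with the
    triangle inequality through [a] and [a']. The height hypotheses serve the cases involving the
    root. *)
Let fam_gromov a a' p t p' t' (e : R) : fam a (p, t) -> fam a' (p', t') ->
  t' <= t + mdist a a' + e -> t <= t' + mdist a a' + e -> 0 <= e ->
  (t + t' - mdist a a') / 2 <= gromov o p p' + e.
Proof.
have aa' := mdist_ge0 a a'.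
case=> [[-> ->]|[b _ [<- <-]]]; case=> [[-> ->]|[b' _ [<- <-]]].
- by rewrite gromov_root; lra.
- by rewrite gromov_sym gromov_root; lra.
- by rewrite gromov_root; lra.
- move=> _ _ e0; have := f1 b b'.
  have -> : mdist b b' = mdist (set_val b) (set_val b') by [].
  have := metric_triangle (set_val b) a (set_val b').
  have := metric_triangle a a' (set_val b').
  rewrite (metric_sym (set_val b) a) /gromov; lra.
Qed.

Let fam_pair a p t p' t' : fam a (p, t) -> fam a (p', t') ->
  Num.min t t' <= gromov o p p'.
Proof.
move=> fpt fpt'.
case: fpt' (fpt) => [[-> ->] _|[b' _ [<- <-]]].
  by rewrite gromov_root ge_min lexx orbT.
case=> [[-> ->]|[b _ [<- <-]]].
  by rewrite gromov_sym gromov_root ge_min lexx.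
have := f1 b b'.
have -> : mdist b b' = mdist (set_val b) (set_val b') by [].
have := metric_triangle (set_val b) a (set_val b').
rewrite (metric_sym (set_val b) a) /gromov ge_min => h1 h2.
by apply/orP; have [h|h] := leP (mdist o (f b) - mdist a (set_val b))
  (mdist o (f b') - mdist a (set_val b')); [left|right]; lra.
Qed.

Let fam_ub a : has_ubound (snd @` fam a).
Proof.
have [[b0 _]|noB] := pselect (exists b : B, True); last first.
  by exists 0 => _ [[p t] [[_ ->]|[b _ _]] <- //]; case: noB; exists b.
exists (mdist o (f b0) + mdist a (set_val b0)) =>
  _ [[p t] [[_ ->]|[b _ [_ <-]]] <-] /=.
  by rewrite addr_ge0 ?mdist_ge0.
have := f1 b0 b; have := metric_triangle o (f b0) (f b).
have -> : mdist b0 b = mdist (set_val b0) (set_val b) by [].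
have := metric_triangle (set_val b0) a (set_val b).
rewrite (metric_sym (set_val b0) a); lra.
Qed.

Let height a := sup (snd @` fam a).

Let height_ge a p t : fam a (p, t) -> t <= height a.
Proof. by move=> fpt; apply: ub_le_sup => //; exists (p, t). Qed.

Let height_ge0 a : 0 <= height a.
Proof. by apply: (@height_ge a o); left. Qed.

Let height_le a (c : R) : (forall p t, fam a (p, t) -> t <= c) -> height a <= c.
Proof.
move=> h; apply: ge_sup; first by exists 0, (o, 0) => //; left.
by move=> _ [[p t] fpt <-]; exact: h fpt.
Qed.

Let height_lip a a' : height a <= height a' + mdist a a'.
Proof.
apply: height_le => p t [[_ ->]|[b _ [_ <-]]].
  by rewrite addr_ge0// mdist_ge0.
have : fam a' (f b, mdist o (f b) - mdist a' (set_val b)) by right; exists b.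
move=> /height_ge; have := metric_triangle a' a (set_val b).
rewrite (metric_sym a' a); lra.
Qed.

Lemma rooted_tree_extension : exists g : A -> T,
  (forall a a', mdist (g a) (g a') <= mdist a a') /\
  forall b, g (set_val b) = f b.
Proof.
have /choice[g hg] : forall a, exists q, mdist o q = height a /\
    forall p t, fam a (p, t) -> t <= gromov o q p.
  by move=> a; apply: chainT => //; [left|exact: fam_le|exact: fam_pair].
exists g; split=> [a a'|b]; last first.
  have [hq hA] := hg (set_val b).
  (* On [B] the family contains the full height of [f b], and no member exceeds it, so [g] must take
     the value [f b]. *)
  have hb : height (set_val b) <= mdist o (f b).
    apply: height_le => p t [[_ ->]|[b' _ [_ <-]]]; first exact: mdist_ge0.
    have := f1 b b'; have := metric_triangle o (f b) (f b').
    by have -> : mdist b b' = mdist (set_val b) (set_val b') by []; lra.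
  have := hA (f b) (mdist o (f b) - mdist (set_val b) (set_val b)).
  rewrite mdistxx subr0 /gromov hq => /(_ _) h.
  apply: mdist_positivity; apply/eqP; rewrite eq_le mdist_ge0 andbT.
  have {}h := h ltac:(by right; exists b => //; rewrite mdistxx subr0); lra.
have [hq hA] := hg a; have [hq' hA'] := hg a'.
apply/ler_addgt0Pl => e e0; have e4 : 0 < e / 4 by lra.
have hs c : has_sup (snd @` fam c).
  by split=> //; exists 0, (o, 0) => //; left.
(* Members within [e / 4] of the top represent [g a] and [g a']. Hyperbolicity along [g a], [p],
   [p'], [g a'] bounds the product of [g a] and [g a'] below by one of [t], [t'] and the product of
   [p] and [p']; the total error, doubled, stays within [e]. *)
have [_ [[p t] fpt /= <-] tq] := sup_adherent e4 (hs a).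
have [_ [[p' t'] fpt' /= <-] tq'] := sup_adherent e4 (hs a').
rewrite -/(height a) in tq; rewrite -/(height a') in tq'.
have := hypT (g a) p (g a'); have := hypT p p' (g a').
have := hA _ _ fpt; have := hA' _ _ fpt'.
have := height_lip a a'; have := height_lip a' a; rewrite (metric_sym a' a).
have := height_ge0 a; have := height_ge0 a'.
have := height_ge fpt; have := height_ge fpt'.
move=> ht' ht h0' h0 l' l gp' gp.
have tt' : t' <= t + mdist a a' + e / 4 by lra.
have t't : t <= t' + mdist a a' + e / 4 by lra.
have := fam_gromov fpt fpt' tt' t't (ltW e4).
rewrite (gromov_sym o p' (g a')) in gp' *.
rewrite !ge_min => h /orP h1 /orP h2.
suff : height a + height a' - (mdist a a' + e) <= 2 * gromov o (g a) (g a').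
  by rewrite {1}/gromov hq hq'; lra.
by case: h2 => h2; [lra|case: h1 => h1; lra].
Qed.


End injectivity.

Lemma rooted_tree_injective o : zero_hyperbolic o -> rooted_chain_complete o ->
  injective_space T.
Proof.
move=> hypT chainT A B f /lipschitz_with1P f1.
have [g [g1 gf]] := rooted_tree_extension hypT chainT f1.
by exists g; split=> //; apply/lipschitz_with1P.
Qed.

(** Distance from [x] is an isometry of a segment onto an interval. For the gluing axiom, the point
    where the segments from [y] to [x] and [z] part lies on both, so it is [y]. *)
Lemma hyperbolic_R_tree o : zero_hyperbolic o -> geodesic_space T -> R_tree T.
Proof.
move=> hypT geoT.
have four := four_points hypT.
have seg (x y : T) (t : R) : 0 <= t <= mdist x y ->
    exists z, mdist x z = t /\ mdist z y = mdist x y - t.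
  move=> t0D; have [g [g1 g0 gD]] := geoT x y; exists (g t).
  have h1 := g1 0 t; have h2 := g1 t (mdist x y).
  have h3 := metric_triangle x (g t) y.
  by move: h1 h2; rewrite g0 gD ler0_norm ?ler0_norm; lra.
split=> [x y|x y z xyz].
- have phiP (s : segment x y) : (mdist x (val s) : R^o) \in real_itv 0 (mdist x y).
    apply/mem_set.
    have E : mdist x y = mdist x (val s) + mdist (val s) y := set_mem (valP s).
    suff : 0 <= mdist x (val s) <= mdist x y by [].
    by have := mdist_ge0 x (val s); have := mdist_ge0 (val s) y; lra.
  exists (fun s => SigSub (phiP s)); split; last first.
    apply/seteqP; split=> // t _.
    have /seg[z [xz zy]] : 0 <= (val t : R) <= mdist x y := set_mem (valP t).
    have zP : z \in segment x y by apply/mem_set; rewrite /segment/= xz zy; lra.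
    by exists (SigSub zP) => //; apply: val_inj.
  move=> s s'.
  have -> : mdist s s' = mdist (val s) (val s') by [].
  rewrite -[LHS]/(`|mdist x (val s') - mdist x (val s)|).
  have : mdist x y = mdist x (val s) + mdist (val s) y := set_mem (valP s).
  have : mdist x y = mdist x (val s') + mdist (val s') y := set_mem (valP s').
  have := four x y (val s) (val s').
  have := metric_triangle x (val s) (val s').
  have := metric_triangle x (val s') (val s).
  rewrite (metric_sym (val s') (val s)) (metric_sym y (val s)).
  rewrite (metric_sym y (val s')).
  move: (val s) (val s') => a b h1 h2.
  rewrite le_max => /orP h3 h4 h5.
  (* The four-point condition for [x], [y], [a], [b], with [mdist x y] split at [a] or at [b]. *)
  have h : mdist a b <= `|mdist x b - mdist x a|.
    have [h6|h6] := leP 0 (mdist x b - mdist x a);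
      [rewrite ger0_norm// | rewrite ltr0_norm//]; case: h3; lra.
  by apply/eqP; rewrite eq_le h andbT ler_norml; lra.
(* [a] is the height above [y] of the branching point [c]. *)
- pose a := gromov y x z.
  have tr1 := metric_triangle y x z; have tr2 := metric_triangle y z x.
  have tr3 := metric_triangle x y z.
  rewrite (metric_sym z x) in tr2; rewrite (metric_sym x y) in tr3 *.
  have a0 : 0 <= a <= mdist y x by rewrite /a /gromov; lra.
  have [c [yc cx]] := seg y x a a0.
  have := four c z y x; rewrite (metric_sym c y) yc cx (metric_sym z x).
  rewrite (metric_sym z y) le_max => /orP h.
  have cz : mdist c z <= mdist y z - a by case: h; rewrite /a /gromov; lra.
  have /(_ c) : forall c, (segment x y `&` segment y z) c -> c = y.
    by move=> c'; rewrite xyz.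
  rewrite /segment/= => cy; have {cy} : c = y.
    apply: cy; have := metric_triangle y c z.
    by rewrite (metric_sym x y) (metric_sym x c) (metric_sym c y) yc cx; split; lra.
  move=> cy; move: yc; rewrite cy mdistxx /a /gromov; lra.
Qed.

End hyperbolic.

(** * A separable injective tree *)

Section ray_tree.
Context {R : realType} {K : countType} (k0 : K) (ell : K -> R).
Implicit Types (s : nat -> K) (r : R).

(* Heights of the vertices on the ray with labels [s]: the first edge has
   length [1 + `|ell (s 0)|] and the [n]-th one has length [2 ^- n]. *)
Definition vertex s (n : nat) : R :=
  if n is m.+1 then 1 + `|ell (s 0%N)| + (1 - half_pow m) else 0.

(** The limit of the vertex heights. Points at this height belong to the tree, which makes it
    complete. *)
Definition ray_end s : R := 2 + `|ell (s 0%N)|.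

Lemma vertex_ge0 s n : 0 <= vertex s n.
Proof.
case: n => [//|n]; have := @half_pow_le1 R n.
by have := normr_ge0 (ell (s 0%N)); rewrite /vertex; lra.
Qed.

Lemma vertex_lt_end s n : vertex s n < ray_end s.
Proof.
rewrite /ray_end; case: n => [|n] /=; have := normr_ge0 (ell (s 0%N)); first lra.
by have := @half_pow_gt0 R n; lra.
Qed.

Lemma vertex_le s m n : (m <= n)%N -> vertex s m <= vertex s n.
Proof.
case: m => [|m]; first by move=> _; exact: vertex_ge0.
by case: n => [//|n] mn /=; have := @half_pow_le R m n mn; lra.
Qed.

Lemma vertex_unbounded s r : r < ray_end s -> exists n, r <= vertex s n.
Proof.
move=> rs; have [n hn] := @half_pow_small R (ray_end s - r) ltac:(lra).
by exists n.+1; move: hn; rewrite /ray_end /=; lra.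
Qed.

(** The label [s n] belongs to the edge starting at [vertex s n]. The inequality is strict, so rays
    parting at a vertex still agree up to its height. *)
Definition agree s s' r := forall n, vertex s n < r -> s n = s' n.

Lemma agree_head s s' r : agree s s' r -> 0 < r -> s 0%N = s' 0%N.
Proof. by move=> a r0; exact: (a 0%N). Qed.

Lemma eq_vertex s s' : s 0%N = s' 0%N -> vertex s =1 vertex s'.
Proof. by move=> ss' [//|n]; rewrite /vertex ss'. Qed.

Lemma agree_le0 s s' r : r <= 0 -> agree s s' r.
Proof. by move=> r0 n; rewrite ltNge (le_trans r0 (vertex_ge0 _ _)). Qed.

(** Vertex heights depend only on the first label, which is shared as soon as [r] is positive. *)
Lemma agree_sym s s' r : agree s s' r -> agree s' s r.
Proof.
move=> a n; have [r0|r0] := leP r 0; first exact: agree_le0.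
by rewrite -(eq_vertex (agree_head a r0)) => /a.
Qed.

Lemma agree_trans s' s s'' r : agree s s' r -> agree s' s'' r -> agree s s'' r.
Proof.
move=> a b n; have [r0|r0] := leP r 0; first exact: agree_le0.
by move=> h; rewrite a// b// -(eq_vertex (agree_head a r0)).
Qed.

Lemma agree_le s s' r r' : r <= r' -> agree s s' r' -> agree s s' r.
Proof. by move=> rr' a n h; apply: a; exact: lt_le_trans rr'. Qed.

(* Labels beyond the height of the point are set to [k0], so that points are
   equal when they have the same height and the same labels below it. *)
Record ray_tree := RayTree {
  dir : nat -> K ;
  height : R ;
  height_bounds : 0 <= height <= ray_end dir ;
  dir_above : forall n, height <= vertex dir n -> dir n = k0
}.
Implicit Types p q : ray_tree.

HB.instance Definition _ := gen_eqMixin ray_tree.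
HB.instance Definition _ := gen_choiceMixin ray_tree.

Lemma ray_treeP p q : height p = height q -> agree (dir p) (dir q) (height p) ->
  p = q.
Proof.
move=> hpq a; have dE : dir p = dir q.
  apply/funext => n; have [h|h] := leP (height p) (vertex (dir p) n); last exact: a.
  rewrite dir_above//.
  have [h0|h0] := leP (height p) 0.
    by rewrite dir_above// -hpq (le_trans h0)// vertex_ge0.
  by rewrite dir_above// -hpq -(eq_vertex (agree_head a h0)).
case: p q hpq dE a => [s h b c] [s' h' b' c'] /= E E' _.
subst; congr RayTree; exact: Prop_irrelevance.
Qed.

Definition meets p q : set R :=
  [set r | [/\ r <= height p, r <= height q & agree (dir p) (dir q) r]].

Definition meet p q : R := sup (meets p q).

Let meets0 p q : meets p q 0.
Proof.
have /andP[p0 _] := height_bounds p; have /andP[q0 _] := height_bounds q.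
by split=> //; exact: agree_le0.
Qed.

Lemma le_meet p q r : meets p q r -> r <= meet p q.
Proof. by move=> h; apply: ub_le_sup h; exists (height p) => ? []. Qed.

Lemma meet_ge0 p q : 0 <= meet p q.
Proof. exact: le_meet. Qed.

(** The supremum is attained: every vertex strictly below it is also strictly below some member of
    [meets p q]. *)
Lemma meetP p q : meets p q (meet p q).
Proof.
split; [by apply: ge_sup => [|r []//]; exists 0 ..|] => n hn.
have hs : has_sup (meets p q) by split; [exists 0|exists (height p) => ? []].
have [|r [_ _ a] hr] := @sup_adherent _ _ (meet p q - vertex (dir p) n) _ hs.
  by rewrite subr_gt0.
by apply: a; move: hr; rewrite -/(meet p q); lra.
Qed.

Lemma meet_lel p q : meet p q <= height p.
Proof. by case: (meetP p q). Qed.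

Lemma meet_ler p q : meet p q <= height q.
Proof. by case: (meetP p q). Qed.

Lemma meet_sym p q : meet p q = meet q p.
Proof.
have h u v : meet u v <= meet v u.
  by apply: le_meet; have [a b c] := meetP u v; split=> //; exact: agree_sym.
by apply/eqP; rewrite eq_le !h.
Qed.

Lemma meetpp p : meet p p = height p.
Proof.
by apply/eqP; rewrite eq_le meet_lel/=; apply: le_meet; split=> // n.
Qed.

(** Agreement up to a given height is transitive. This ultrametric inequality yields both the
    triangle inequality and hyperbolicity. *)
Lemma meet_hyperbolic p q (r : ray_tree) : Num.min (meet p q) (meet q r) <= meet p r.
Proof.
have [a1 a2 a3] := meetP p q; have [b1 b2 b3] := meetP q r.
apply: le_meet; split; rewrite ?ge_min ?a1 ?b2 ?orbT//.
apply: (@agree_trans (dir q)); [apply: agree_le a3|apply: agree_le b3];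
  by rewrite ge_min lexx ?orbT.
Qed.

Definition ray_tree_dist p q : R := height p + height q - 2 * meet p q.

Let distxx p : ray_tree_dist p p = 0.
Proof. by rewrite /ray_tree_dist meetpp; lra. Qed.

Let dist_positivity p q : ray_tree_dist p q = 0 -> p = q.
Proof.
rewrite /ray_tree_dist => h.
have := meet_lel p q; have := meet_ler p q => h1 h2.
have hp : meet p q = height p by lra.
by apply: ray_treeP; [lra|rewrite -hp; case: (meetP p q)].
Qed.

Let dist_sym p q : ray_tree_dist p q = ray_tree_dist q p.
Proof. by rewrite /ray_tree_dist meet_sym; lra. Qed.

Let dist_triangle q p (r : ray_tree) :
  ray_tree_dist p r <= ray_tree_dist p q + ray_tree_dist q r.
Proof.
have := meet_hyperbolic p q r; rewrite ge_min /ray_tree_dist => /orP h.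
have := meet_ler p q; have := meet_lel q r; by case: h; lra.
Qed.

HB.instance Definition _ := @isMetric.Build R ray_tree ray_tree_dist
  distxx dist_positivity dist_sym dist_triangle.

Lemma mdist_ray_treeE p q : mdist p q = height p + height q - 2 * meet p q.
Proof. by []. Qed.

Section truncation.
Variables (s : nat -> K) (r : R).

Let hgt := Num.max 0 (Num.min r (ray_end s)).
Let lab n := if vertex s n < hgt then s n else k0.

Let ray_end_ge0 s' : 0 <= ray_end s'.
Proof. by have := normr_ge0 (ell (s' 0%N)); rewrite /ray_end; lra. Qed.

Let lab0 : 0 < hgt -> lab 0%N = s 0%N.
Proof. by rewrite /lab /= => ->. Qed.

Let point_bounds : 0 <= hgt <= ray_end lab.
Proof.
have [h|h] := ltP 0 hgt.
  rewrite (ltW h) /= /ray_end lab0// -/(ray_end s) /hgt ge_max ray_end_ge0/=.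
  by rewrite ge_min lexx orbT.
have -> : hgt = 0 by apply/eqP; rewrite eq_le h/= /hgt le_max lexx.
by rewrite lexx ray_end_ge0.
Qed.

Let point_above n : hgt <= vertex lab n -> lab n = k0.
Proof.
rewrite /lab; case: ifPn => // vh.
have h0 : 0 < hgt by apply: le_lt_trans vh; exact: vertex_ge0.
by rewrite (eq_vertex (lab0 h0)) leNgt vh.
Qed.

(** The height is clamped to the ray and the labels of vertices at or above it are erased, so any
    [s] and [r] give a point. *)
Definition ray_point := RayTree point_bounds point_above.

Lemma height_ray_point : 0 <= r <= ray_end s -> height ray_point = r.
Proof. by move=> /andP[h0 h1]; rewrite /= /hgt min_l// max_r. Qed.

Lemma agree_ray_point : agree s (dir ray_point) (height ray_point).
Proof. by move=> n /=; rewrite /lab => ->. Qed.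

End truncation.

Definition ray_root := ray_point (fun=> k0) 0.

Lemma height_ray_root : height ray_root = 0.
Proof. by apply: height_ray_point; rewrite lexx /ray_end addr_ge0. Qed.

Lemma gromov_ray_root p q : gromov ray_root p q = meet p q.
Proof.
have m0 v : meet ray_root v = 0.
  apply/eqP; rewrite eq_le meet_ge0 andbT.
  by apply: le_trans (meet_lel _ _) _; rewrite height_ray_root.
by rewrite /gromov !mdist_ray_treeE !m0 height_ray_root; lra.
Qed.

Lemma ray_tree_hyperbolic : zero_hyperbolic ray_root.
Proof. by move=> p q r; rewrite !gromov_ray_root; exact: meet_hyperbolic. Qed.

Lemma mdist_ray_root p : mdist ray_root p = height p.
Proof.
by have := gromov_ray_root p p; rewrite /gromov mdistxx meetpp; lra.
Qed.

(** The [n]-th label of the upper end is the common [n]-th label of all members of [A] reaching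
    strictly above that vertex, and [k0] if there is none. All members of positive height share the
    first label, hence the same [ray_end], which bounds the supremum. *)
Lemma ray_tree_chain_complete : rooted_chain_complete ray_root.
Proof.
move=> A A0 Aht Apair Aub.
have Hle p t : A (p, t) -> t <= height p by move=> /Aht; rewrite mdist_ray_root.
set S := sup (snd @` A).
have SA p t : A (p, t) -> t <= S by move=> h; apply: ub_le_sup => //; exists (p, t).
have hasS : has_sup (snd @` A) by split=> //; exists 0, (ray_root, 0).
have S0 : 0 <= S by exact: SA A0.
pose above n (k : K) := exists p t,
  [/\ A (p, t), vertex (dir p) n < t & k = dir p n].
have agr p t p' t' : A (p, t) -> A (p', t') ->
    agree (dir p) (dir p') (Num.min t t').
  move=> h h'; have := Apair _ _ _ _ h h'; rewrite gromov_ray_root => hm.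
  by apply: agree_le hm _; case: (meetP p p').
have above_uniq n k k' : above n k -> above n k' -> k = k'.
  move=> [p [t [h v ->]]] [p' [t' [h' v' ->]]].
  have a := agr _ _ _ _ h h'; apply: (a); rewrite lt_min v/=.
  rewrite (eq_vertex (agree_head a _))// lt_min.
  by rewrite (le_lt_trans (vertex_ge0 _ _) v) (le_lt_trans (vertex_ge0 _ _) v').
have lab n : exists k, (forall k', above n k' -> k = k') /\
    ((forall k', ~ above n k') -> k = k0).
  have [[k hk]|no] := pselect (exists k, above n k).
    by exists k; split=> [k' /(above_uniq _ _ _ hk)//|/(_ k)].
  by exists k0; split=> // k' hk'; case: no; exists k'.
have [s hs] := choice lab.
have s0 p t : A (p, t) -> 0 < t -> s 0%N = dir p 0%N.
  by move=> h t0; apply: (proj1 (hs 0%N)); exists p, t.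
have Send : S <= ray_end s.
  apply: ge_sup; first by exists 0, (ray_root, 0).
  move=> _ [[p t] h <-] /=; have [t0|t0] := leP t 0.
    by apply: le_trans t0 _; rewrite /ray_end addr_ge0.
  rewrite /ray_end (s0 p t)//; apply: le_trans (Hle _ _ h) _.
  by case/andP: (height_bounds p).
have bounds : 0 <= S <= ray_end s by rewrite S0.
exists (ray_point s S); split.
  by rewrite mdist_ray_root height_ray_point.
move=> p t h; rewrite gromov_ray_root; have [t0|t0] := leP t 0.
  by apply: le_trans t0 _; exact: meet_ge0.
apply: le_meet; split; [by rewrite height_ray_point//; exact: SA h|exact: Hle|].
apply: (@agree_trans s).
  apply: agree_sym; apply: agree_le (@agree_ray_point s S).
  by rewrite height_ray_point//; exact: SA h.
move=> n; rewrite (eq_vertex (s0 _ _ h t0)) => v.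
by apply: (proj1 (hs n)); exists p, t.
Qed.

Lemma ray_tree_injective : injective_space ray_tree.
Proof.
exact: rooted_tree_injective ray_tree_hyperbolic ray_tree_chain_complete.
Qed.

Lemma ray_tree_R_tree : R_tree ray_tree.
Proof.
apply: hyperbolic_R_tree ray_tree_hyperbolic _.
exact: injective_geodesic ray_tree_injective.
Qed.

(** A point strictly below the end of its ray involves finitely many labels, so finite label lists
    with rational heights are dense. *)
Lemma ray_tree_separable : separable ray_tree.
Proof.
pose D := [set ray_point (nth k0 lq.1) (ratr lq.2) | lq in [set: seq K * rat]].
exists D; first exact: card_le_trans (card_image_le _ _) (countableP _).
have h p (e : R) : 0 < e -> exists2 d, D d & mdist p d < e.
  move=> e0; have /andP[p0 pe] := height_bounds p.
  have close s r : 0 <= r <= ray_end s -> r <= height p -> height p - e < r ->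
      agree (dir p) s r -> mdist p (ray_point s r) < e.
    move=> rs rp pr a; rewrite mdist_ray_treeE height_ray_point//.
    suff : r <= meet p (ray_point s r) by lra.
    apply: le_meet; split; rewrite ?height_ray_point//.
    apply: agree_trans a _; have := @agree_ray_point s r.
    by rewrite height_ray_point.
  have [pe0|pe0] := ltP (height p) e.
    exists (ray_point (nth k0 [::]) (ratr 0)); first by exists ([::], 0).
    rewrite rmorph0; apply: close => //; last exact: agree_le0.
      by rewrite lexx addr_ge0.
    lra.
  have [q] := rat_in_itvoo (ltac:(lra) : height p - e < height p).
  rewrite in_itv/= => /andP[q1 q2].
  have [N hN] := vertex_unbounded (lt_le_trans q2 pe).
  (* The list must record the first label, which determines [ray_end]. *)
  have N0 : (0 < N)%N by case: N hN => //=; lra.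
  pose l := mkseq (dir p) N.
  have lE n : (n < N)%N -> dir p n = nth k0 l n by move=> nN; rewrite nth_mkseq.
  exists (ray_point (nth k0 l) (ratr q)); first by exists (l, q).
  apply: close => //; last 2 first.
  - exact: ltW.
  - move=> n nq; apply: lE; rewrite ltnNge; apply/negP => Nn.
    by have := vertex_le (dir p) Nn; lra.
  by rewrite /ray_end -lE// -/(ray_end (dir p)); lra.
exact ((denseP _).2 h).
Qed.

(** The tree distance goes down one ray to the meeting height and up the other; at that height both
    rays have the same value. *)
Lemma ray_tree_map (X : metricType R) (g : (nat -> K) -> R -> X) :
  (forall s r r', 0 <= r <= r' -> mdist (g s r) (g s r') <= r' - r) ->
  (forall s s' r, 0 <= r -> agree s s' r -> g s r = g s' r) ->
  forall p q, mdist (g (dir p) (height p)) (g (dir q) (height q)) <= mdist p q.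
Proof.
move=> g1 gE p q; have [mp mq a] := meetP p q; have m0 := meet_ge0 p q.
apply: le_trans (metric_triangle _ (g (dir p) (meet p q)) _) _.
rewrite mdist_ray_treeE metric_sym.
have h1 := g1 (dir p) (meet p q) (height p) ltac:(by rewrite m0).
have h2 := g1 (dir q) (meet p q) (height q) ltac:(by rewrite m0).
rewrite -(gE _ _ _ m0 a) in h2; lra.
Qed.

End ray_tree.

(** * Parametrization by the tree *)

Section tree_parametrization.
Context {R : realType} {X : metricType R} (cX : lipschitz_connected X).

Let dI (x y : X) : R := @mdist R (intrinsic_space cX) x y.

Let le_dI (x y : X) : mdist x y <= dI x y.
Proof. exact: mdist_le_intrinsic. Qed.

(** A path of Lipschitz constant [L] is rescaled to unit speed and continued by constants. *)
Let intrinsic_arc (x y : X) (L : R) : dI x y < L -> exists h : R -> X,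
  [/\ forall t, t <= 0 -> h t = x, forall t, L <= t -> h t = y
    & forall a b, a <= b -> mdist (h a) (h b) <= b - a].
Proof.
move=> xyL; have L0 : 0 < L by apply: le_lt_trans xyL; exact: mdist_ge0.
have [p [p0 p1] /(LipP _ (ltW L0)) pL] := intrinsic_mdist_path cX xyL.
exists (fun t => p (to_unit_itv (t / L))); split=> [t t0|t tL|a b ab].
- rewrite -p0; congr p; apply: val_inj => /=.
  rewrite /unit_itv_clamp; apply: max_l; rewrite ge_min; apply/orP; left.
  by rewrite pmulr_lle0// invr_gt0.
- rewrite -p1; congr p; apply: val_inj => /=.
  rewrite /unit_itv_clamp min_r; first exact: max_r.
  by rewrite ler_pdivlMr// mul1r.
- have abL : a / L <= b / L by rewrite ler_pM2r// invr_gt0.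
  have [h1 h2] := unit_itv_clamp_le abL.
  apply: le_trans (pL _ _) _; rewrite mdist_unit_itvE /= ger0_norm; last lra.
  have -> : b - a = L * (b / L - a / L).
    by rewrite -mulrBl mulrC divfK// gt_eqF.
  by rewrite ler_pM2l.
Qed.

Variables (x0 : X) (xs : nat -> X).
Hypothesis xs_dense : forall x (e : R), 0 < e -> exists n, dI x (xs n) < e.
Variables (P : metricType R) (p0 : P) (es : nat -> P).
Hypothesis es_dense : forall p (e : R), 0 < e -> exists n, mdist p (es n) < e.
Variables (cP : complete_space P) (f : P -> X).
Hypotheses (f_cont : continuous f) (f_surj : surjective f).

Let K : countType := (nat * nat)%type.
(** This makes the first edge longer than the intrinsic distance from [x0] to the first target, so
    one jump reaches any [xs] even when the intrinsic metric is unbounded. *)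
Let ell (k : K) : R := dI x0 (xs k.1).
Let vtx := vertex ell.
Let edge (s : nat -> K) n : R := vtx s n.+1 - vtx s n.

Let edge0 s : edge s 0 = 1 + `|ell (s 0%N)|.
Proof. by rewrite /edge /vtx /= half_pow0; lra. Qed.

Let edgeS s n : edge s n.+1 = half_pow n.+1.
Proof. by rewrite /edge /vtx /=; have := @half_powS R n; lra. Qed.

Let edge_gt0 s n : 0 < edge s n.
Proof.
case: n => [|n]; last by rewrite edgeS half_pow_gt0.
by rewrite edge0; have := normr_ge0 (ell (s 0%N)); lra.
Qed.

(* The label [k] is followed from the state [(y, p)] only if [xs k.1] is close
   to [y] for the intrinsic metric, [es k.2] is close to [p], and [xs k.1] is
   close to the image of a point which is close to [es k.2]. Otherwise the state
   does not change; hence every sequence of labels yields a convergent sequence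
   of states. *)
Let admissible n (L : R) (k : K) (st : X * P) : Prop :=
  [/\ dI st.1 (xs k.1) < L, n = 0%N \/ mdist st.2 (es k.2) < half_pow n
    & exists z, mdist z (es k.2) <= half_pow n /\
        mdist (xs k.1) (f z) <= half_pow n].

Let step n L k st :=
  if `[< admissible n L k st >] then (xs k.1, es k.2) else st.

Let state s := fix state n : X * P :=
  if n is m.+1 then step m (edge s m) (s m) (state m) else (x0, p0).

Let y s n := (state s n).1.

Let stateS s n : state s n.+1 = step n (edge s n) (s n) (state s n).
Proof. by []. Qed.

Let dI_y s n : dI (y s n) (y s n.+1) < edge s n.
Proof.
rewrite /y stateS /step; case: asboolP => [[]//|_].
by rewrite /dI mdistxx edge_gt0.
Qed.

Let state_agree s s' n : (forall m, (m < n)%N -> s m = s' m) ->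
  state s n = state s' n.
Proof.
elim: n => [//|n IH] ss'; rewrite !stateS IH; last first.
  by move=> m mn; apply: ss'; exact: ltnW.
by rewrite ss'// /edge /vtx !(eq_vertex _ (ss' 0%N isT)).
Qed.

(** The second components converge to some [z0]. If only finitely many labels are admissible, [y s]
    is eventually constant. Otherwise, at admissible indices it is close to values of [f] at points
    tending to [z0]; continuity gives the limit [f z0], and the geometric steps control the other
    indices. *)
Let y_cvg s : exists l : X, y s @ \oo --> l.
Proof.
have y_step n : mdist (y s n.+1) (y s n.+2) <= 1 * half_pow n.
  rewrite mul1r; apply: le_trans (le_dI _ _) _; apply: ltW.
  apply: lt_le_trans (dI_y s n.+1) _; rewrite edgeS; exact: half_pow_le.
pose p n := (state s n.+1).2.
have p_step n : mdist (p n) (p n.+1) <= half_pow n.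
  rewrite /p (stateS s n.+1) /step; case: asboolP => [[_ [//|h] _]|_] /=.
    by apply: le_trans (ltW h) _; exact: half_pow_le.
  by rewrite mdistxx half_pow_ge0.
have [z0 hz0] := (complete_spaceP _).1 cP p p_step.
pose adm n := admissible n (edge s n) (s n) (state s n).
have [[N hN]|hN] := pselect (exists N, forall n, (N <= n)%N -> ~ adm n).
  exists (y s N); apply/cvg_mdistP => e e0; exists N => n /subnKC <-.
  suff -> : y s (N + (n - N))%N = y s N by rewrite mdistxx.
  elim: (n - N)%N => [|k IH]; first by rewrite addn0.
  rewrite addnS /y stateS /step; case: asboolP => //.
  by move=> /hN; case; rewrite leq_addr.
have often N : exists2 n, (N <= n)%N & adm n.
  apply: contrapT => h; apply: hN; exists N => n Nn an; apply: h.
  by exists n.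
exists (f z0); apply/cvg_mdistP => e e0.
have e3 : 0 < e / 3 by lra.
have : nbhs (f z0) [set x | mdist (f z0) x < e / 3].
  by apply/near_mdistP; exists (e / 3).
move=> /f_cont /near_mdistP[d d0 hd].
(* Below, [z] is within [3 * half_pow n] of [z0], and [y s m.+1] within [3 * half_pow m] of
   [f z]. *)
have [N1 hN1] := @half_pow_small R (d / 3) ltac:(lra).
have [N2 hN2] := @half_pow_small R (e / 9) ltac:(lra).
pose N := maxn N1 N2; exists N.+1 => -[//|m] Nm.
have [n mn an] := often m.+1.
have En : state s n.+1 = (xs (s n).1, es (s n).2).
  by rewrite stateS /step asboolT.
have [_ _ [z [zn fz]]] := an.
have Nm' : (N <= m)%N by [].
have mn' : (m <= n)%N := ltnW mn.
have l1 : half_pow n <= half_pow N1 :> R.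
  exact: half_pow_le (leq_trans (leq_maxl _ _) (leq_trans Nm' mn')).
have l2 : half_pow m <= half_pow N2 :> R.
  exact: half_pow_le (leq_trans (leq_maxr _ _) Nm').
have l3 : half_pow n <= half_pow m :> R by exact: half_pow_le.
have n0 := @half_pow_gt0 R n.
have zz0 : mdist z0 z < d.
  have := metric_triangle z0 (es (s n).2) z; have := hz0 n.
  rewrite /p En /= (metric_sym z0 (es _)) (metric_sym (es _) z); lra.
have := hd z zz0; rewrite /= => fz0.
have /= := geometric_mdist y_step mn'; rewrite [y s n.+1]/y En /= => ymn.
have t1 := metric_triangle (y s m.+1) (xs (s n).1) (f z0).
have t2 := metric_triangle (xs (s n).1) (f z) (f z0).
rewrite (metric_sym (f z) (f z0)) in t2.
move: fz fz0 ymn t1 t2; lra.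
Qed.

(** One arc is fixed for each pair of ends and each length, so that rays with the same labels follow
    the same arcs. *)
Let arcs : exists h : X * X * R -> R -> X, forall u, dI u.1.1 u.1.2 < u.2 ->
  [/\ forall t, t <= 0 -> h u t = u.1.1, forall t, u.2 <= t -> h u t = u.1.2
    & forall a b, a <= b -> mdist (h u a) (h u b) <= b - a].
Proof.
have H (u : X * X * R) : exists h : R -> X, dI u.1.1 u.1.2 < u.2 ->
  [/\ forall t, t <= 0 -> h t = u.1.1, forall t, u.2 <= t -> h t = u.1.2
    & forall a b, a <= b -> mdist (h a) (h b) <= b - a].
  have [/intrinsic_arc[h hh]|_] := ltP (dI u.1.1 u.1.2) u.2; first by exists h.
  by exists (fun=> x0).
by have [h hh] := choice H; exists h.
Qed.

Let arc (x x' : X) (L : R) : R -> X := sval (cid arcs) (x, x', L).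

Let arcP x x' L : dI x x' < L ->
  [/\ forall t, t <= 0 -> arc x x' L t = x,
      forall t, L <= t -> arc x x' L t = x'
    & forall a b, a <= b -> mdist (arc x x' L a) (arc x x' L b) <= b - a].
Proof. by rewrite /arc; case: (cid arcs) => h hh /= /(hh (x, x', L)). Qed.

Let path s := fix path n (t : R) : X :=
  if n is m.+1 then
    if t <= vtx s m then path m t
    else arc (y s m) (y s m.+1) (edge s m) (t - vtx s m)
  else x0.

Let path_end s n t : vtx s n <= t -> path s n t = y s n.
Proof.
case: n => [//|n] h /=; have en := edge_gt0 s n.
have [tn|_] := leP t (vtx s n); first by exfalso; move: en h; rewrite /edge; lra.
have [_ + _] := arcP (dI_y s n); apply.
by move: h; rewrite /edge; lra.
Qed.

Let path_lip s n a b : a <= b -> mdist (path s n a) (path s n b) <= b - a.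
Proof.
elim: n a b => [|n IH] a b ab /=; first by rewrite mdistxx; lra.
have [h0 _ h1] := arcP (dI_y s n).
have [an|an] := leP a (vtx s n); have [bn|bn] := leP b (vtx s n).
- exact: IH.
- apply: le_trans (metric_triangle _ (y s n) _) _.
  have := IH _ _ an; rewrite (path_end (lexx (vtx s n))).
  have := h1 0 (b - vtx s n) ltac:(lra); rewrite (h0 0 (lexx 0)); lra.
- lra.
- by have := h1 (a - vtx s n) (b - vtx s n) ltac:(lra); lra.
Qed.

Let path_agree s s' t n : agree ell s s' t -> path s n t = path s' n t.
Proof.
move=> a; have [t0|t0] := leP t 0.
  have h u : path u n t = x0.
    elim: n => [//|n IH] /=.
    by rewrite (le_trans t0 (vertex_ge0 _ _ _)).
  by rewrite !h.
have vE : vtx s =1 vtx s' := eq_vertex ell (agree_head a t0).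
elim: n => [//|n IH]; rewrite /path -/(path s) -/(path s') -vE.
case: leP => // nt.
have ss' m : (m <= n)%N -> s m = s' m.
  by move=> mn; apply: a; apply: le_lt_trans nt; exact: vertex_le.
have y1 : y s n = y s' n.
  by congr fst; apply: state_agree => m /ltnW; exact: ss'.
have y2 : y s n.+1 = y s' n.+1 by congr fst; exact: state_agree.
by rewrite y1 y2 /edge !vE.
Qed.

(** Below the end of the ray the sequence is eventually constant; from the end on it is [y s]. *)
Let path_cvg s t : exists l : X, (fun n => path s n t) @ \oo --> l.
Proof.
have [/vertex_unbounded[N hN]|h] := ltP t (ray_end ell s).
  exists (path s N t); apply/cvg_mdistP => e e0; exists N => n /subnKC <-.
  suff -> : path s (N + (n - N))%N t = path s N t by rewrite mdistxx.
  elim: (n - N)%N => [|k IH]; first by rewrite addn0.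
  rewrite addnS /= IH ifT//; apply: le_trans hN _.
  by apply: vertex_le; exact: leq_addr.
have [l yl] := y_cvg s; exists l.
rewrite (_ : (fun n => path s n t) = y s)//; apply/funext => n.
apply: path_end; apply: le_trans h; apply: ltW; exact: vertex_lt_end.
Qed.

Let seq_lim (u : nat -> X) : X := xget x0 [set l : X | u @ \oo --> l].

Let seq_limP u l : u @ \oo --> l -> seq_lim u = l.
Proof.
move=> ul; pose L := [set l : X | u @ \oo --> l].
have ul' : L (seq_lim u) by apply: (xgetPex x0); exists l.
apply: mdist_positivity; apply/eqP; rewrite eq_le mdist_ge0 andbT.
apply: (lim_mdist_le ul' ul) => e e0; exists 0%N => n _.
by rewrite mdistxx add0r ltW.
Qed.

Let branch s t : X := seq_lim (fun n => path s n t).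

Let branch_lip s t t' : 0 <= t <= t' ->
  mdist (branch s t) (branch s t') <= t' - t.
Proof.
move=> /andP[_ tt']; have [l hl] := path_cvg s t; have [l' hl'] := path_cvg s t'.
rewrite /branch (seq_limP hl) (seq_limP hl').
apply: (lim_mdist_le hl hl') => e e0; exists 0%N => n _.
by apply: le_trans (path_lip s n tt') _; rewrite lerDl ltW.
Qed.

Let branch_agree s s' t : 0 <= t -> agree ell s s' t -> branch s t = branch s' t.
Proof.
move=> _ a; rewrite /branch; congr seq_lim; apply/funext => n.
exact: path_agree.
Qed.

(** Labels approximating [x] and a preimage [p] of it are all admissible: errors [half_pow n.+2] and
    [half_pow n.+3] add up to less than [half_pow n.+1], the length of the next edge. *)
Let branch_surj x : exists s, branch s (ray_end ell s) = x.
Proof.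
have [p px] : exists p, f p = x.
  by have : [set: X] x by []; rewrite -f_surj => -[p _ <-]; exists p.
have [a ha] := choice (fun n => xs_dense x (half_pow_gt0 n.+2)).
have [b hb] := choice (fun n => es_dense p (half_pow_gt0 n.+2)).
pose s n : K := (a n, b n); exists s.
have sE n : state s n.+1 = (xs (a n), es (b n)).
  elim: n => [|n IH]; rewrite stateS /step asboolT //.
    split=> /=; [|by left|].
      by rewrite edge0 /ell /=; have := ler_norm (dI x0 (xs (a 0%N))); lra.
    exists p; split.
      by apply: le_trans (ltW (hb 0%N)) _; exact: half_pow_le.
    rewrite px metric_sym; apply: le_trans (le_dI _ _) _.
    by apply: le_trans (ltW (ha 0%N)) _; exact: half_pow_le.
  have p2 := @half_powS R n.+1; have p3 := @half_powS R n.+2.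
  have p4 := @half_pow_gt0 R n.+3.
  rewrite IH; split=> /=.
  - rewrite edgeS; have := ha n; have := ha n.+1.
    have := @metric_triangle R (intrinsic_space cX) (xs (a n)) x (xs (a n.+1)).
    rewrite (@metric_sym R (intrinsic_space cX) (xs (a n)) x).
    rewrite -/(dI _ _) -/(dI _ _) -/(dI _ _); lra.
  - right; have := hb n; have := hb n.+1.
    have := metric_triangle (es (b n)) p (es (b n.+1)).
    rewrite (metric_sym (es (b n)) p); lra.
  - exists p; split; first by have := hb n.+1; lra.
    rewrite px metric_sym; apply: le_trans (le_dI _ _) _.
    by have := ha n.+1; lra.
apply: seq_limP; apply/cvg_mdistP => e e0.
have [N hN] := half_pow_small e0; exists N.+1 => -[//|n] Nn.
rewrite path_end; last by apply: ltW; exact: vertex_lt_end.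
rewrite /y sE /= metric_sym; apply: le_lt_trans (le_dI _ _) _.
apply: lt_trans (ha n) _; apply: le_lt_trans hN; apply: half_pow_le.
by apply: leq_trans (leqW (leqnSn n)).
Qed.

(** A tree point is sent to the value of its ray at its height; the ends of the rays already cover
    [X]. *)
Lemma ray_tree_parametrization :
  exists (l : (nat * nat)%type -> R) (F : ray_tree (0, 0)%N l -> X),
    surjective F /\ forall p q, mdist (F p) (F q) <= mdist p q.
Proof.
exists ell, (fun p => branch (dir p) (height p)); split; last first.
  exact: ray_tree_map branch_lip branch_agree.
apply/seteqP; split=> // x _; have [s <-] := branch_surj x.
have e0 : 0 <= ray_end ell s by apply: addr_ge0.
have E (p : ray_tree ((0, 0)%N : K) ell) : height p = ray_end ell s ->
    agree ell s (dir p) (height p) ->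
    branch (dir p) (height p) = branch s (ray_end ell s).
  by move=> -> a; rewrite (branch_agree e0 a).
exists (ray_point _ ell s (ray_end ell s)) => //; apply: E.
  by apply: height_ray_point; rewrite e0 lexx.
exact: agree_ray_point.
Qed.

End tree_parametrization.

(** * The Urysohn space over a separable space *)

Section one_point_extension.
Context {R : realType} {Q : eqType} (d : pseudometric R Q).

(** The conditions on the distances to a point added to [Q]. *)
Definition katetov (k : Q -> R) :=
  forall x y, k x <= k y + d x y /\ d x y <= k x + k y.

Section respecify.
Variables (z : Q) (k : Q -> R) (kP : katetov k).

(** The set [Q] stays fixed: adding a point means moving [z], whose former distances are
    discarded. *)
Definition respecified (x y : Q) : R :=
  if x == z then if y == z then 0 else k y
  else if y == z then k x else d x y.

Let respecifiedxx x : respecified x x = 0.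
Proof. by rewrite /respecified; case: (x == z); rewrite ?pdistxx. Qed.

Let respecified_sym x y : respecified x y = respecified y x.
Proof.
by rewrite /respecified; case: (x == z); case: (y == z) => //; exact: pdist_sym.
Qed.

Let respecified_triangle y x w :
  respecified x w <= respecified x y + respecified y w.
Proof.
have kge0 u : 0 <= k u by have [_] := kP u u; rewrite pdistxx; lra.
rewrite /respecified; case: (x == z); case: (y == z); case: (w == z);
  rewrite ?add0r ?addr0 ?addr_ge0 ?kge0//.
- by have [h _] := kP w y; rewrite (pdist_sym d y).
- by have [_ h] := kP x w.
- by have [h _] := kP x y; rewrite addrC.
- exact: pdist_triangle.
Qed.

Definition respecify : pseudometric R Q :=
  Pseudometric respecifiedxx respecified_sym respecified_triangle.

End respecify.

(* The distance to a new point that lies at distance at most [c.2] from [c.1]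
   for all [c] in the list. *)
Definition min_ext (l : seq (Q * R)) (x : Q) : R :=
  if l is c0 :: l' then
    foldr (fun c m => Num.min (c.2 + d c.1 x) m) (c0.2 + d c0.1 x) l'
  else 0.

Lemma min_ext_le l c x : c \in l -> min_ext l x <= c.2 + d c.1 x.
Proof.
case: l => [//|c0 l]; rewrite inE /min_ext.
elim: l => [|c1 l IH] /=; first by rewrite orbF => /eqP ->.
rewrite inE ge_min => /or3P[cc0|/eqP ->|cl]; rewrite ?lexx//.
  by rewrite IH ?cc0// orbT.
by rewrite IH ?cl ?orbT.
Qed.

Lemma min_ext_attained l x : l != [::] ->
  exists2 c, c \in l & min_ext l x = c.2 + d c.1 x.
Proof.
case: l => [//|c0 l] _; rewrite /min_ext.
elim: l => [|c1 l [c cl IH]] /=; first by exists c0; rewrite ?mem_head.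
rewrite IH; case: leP => _; first by exists c1; rewrite // !inE eqxx orbT.
by exists c => //; move: cl; rewrite !inE => /orP[->//|->]; rewrite !orbT.
Qed.

Definition spread_list (l : seq (Q * R)) :=
  l <> [::] /\ forall c c', c \in l -> c' \in l -> d c.1 c'.1 <= c.2 + c'.2.

(** A minimum of 1-Lipschitz functions is 1-Lipschitz; the lower bound on sums comes from the spread
    condition. *)
Lemma min_ext_katetov l : spread_list l -> katetov (min_ext l).
Proof.
move=> [/eqP l0 lP] x y.
have [c cl xE] := min_ext_attained x l0; have [c' cl' yE] := min_ext_attained y l0.
split.
  apply: le_trans (min_ext_le x cl') _; rewrite yE (pdist_sym d x y).
  by have := pdist_triangle d y c'.1 x; lra.
rewrite xE yE; have := lP _ _ cl cl'; have := pdist_triangle d c.1 x y.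
have := pdist_triangle d c'.1 c.1 y; rewrite (pdist_sym d x c.1); lra.
Qed.

Definition add_point (z : Q) (l : seq (Q * R)) : pseudometric R Q :=
  if pselect (spread_list l) is left h then respecify z (min_ext_katetov h)
  else d.

Lemma add_point_old z l x y : x != z -> y != z -> add_point z l x y = d x y.
Proof.
rewrite /add_point; case: pselect => //= h /negPf xz /negPf yz.
by rewrite /respecified xz yz.
Qed.

Lemma add_point_new z l x : spread_list l -> x != z ->
  add_point z l z x = min_ext l x.
Proof.
rewrite /add_point; case: pselect => //= h _ /negPf xz.
by rewrite /respecified eqxx xz.
Qed.

End one_point_extension.

(** By the pigeonhole principle. It lets a list be treated at a stage later than all the points it
    mentions. *)
Lemma inj_unbounded (g : nat -> nat) : injective g ->
  forall M, exists j, (M <= g j)%N.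
Proof.
move=> ginj M; apply: contrapT => h.
have gM j : (g j < M)%N by rewrite ltnNge; apply/negP => hj; apply: h; exists j.
have hinj : injective (fun j : 'I_M.+1 => Ordinal (gM j)).
  by move=> j j' [/ginj/val_inj].
by have := leq_card _ hinj; rewrite !card_ord ltnn.
Qed.

Section urysohn.
Context {R : realType} {T : metricType R} (ts : nat -> T).
Hypothesis ts_dense : forall t (e : R), 0 < e -> exists n, mdist t (ts n) < e.

Let Q : eqType := (T + nat)%type.

Let proj (x : Q) : T := if x is inl t then t else ts 0%N.

(* The points [inr n] are first glued to [ts 0], then moved one by one. *)
Program Definition glued : pseudometric R Q :=
  @Pseudometric R Q (fun x y => mdist (proj x) (proj y)) _ _ _.
Next Obligation. by move=> *; exact: mdistxx. Qed.
Next Obligation. by move=> *; exact: metric_sym. Qed.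
Next Obligation. by move=> *; exact: metric_triangle. Qed.

Let code := ((nat + nat) * rat)%type.

Let coded (i : nat + nat) : Q :=
  match i with inl i => inl (ts i) | inr m => inr m end.

Let decode (c : code) : Q * R := (coded c.1, ratr c.2).

(** The second component of the pickled pair is a dummy that makes every list occur infinitely
    often. The default [[::]] is not spread, so such a stage changes nothing. *)
Let codes (n : nat) : seq (Q * R) :=
  if @choice.unpickle (seq code * nat)%type n is Some lj
  then map decode lj.1 else [::].

Let stage := fix stage n : pseudometric R Q :=
  if n is m.+1 then add_point (stage m) (inr m) (codes m) else glued.

(** The point [inr m] is moved in passing to stage [m.+1]; distances between points of index at most
    [n] are final from stage [n] on. *)
Let idx (x : Q) : nat := if x is inr m then m.+1 else 0%N.

Let stage_stable n k x y : (idx x <= n)%N -> (idx y <= n)%N ->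
  stage (n + k)%N x y = stage n x y.
Proof.
move=> xn yn; elim: k => [|k IH]; first by rewrite addn0.
have old w : (idx w <= n)%N -> w != inr (n + k)%N.
  move=> wn; apply/eqP => wE; move: wn; rewrite wE /=.
  by rewrite ltnNge leq_addr.
by rewrite addnS /= add_point_old ?old.
Qed.

Let udist (x y : Q) : R := stage (maxn (idx x) (idx y)) x y.

Let udistE n x y : (idx x <= n)%N -> (idx y <= n)%N -> udist x y = stage n x y.
Proof.
move=> xn yn; rewrite /udist.
rewrite -(@stage_stable _ (n - maxn (idx x) (idx y))) ?leq_maxl ?leq_maxr//.
by rewrite subnKC// geq_max xn.
Qed.

Let udistxx x : udist x x = 0.
Proof. exact: pdistxx. Qed.

Let udist_sym x y : udist x y = udist y x.
Proof. by rewrite /udist pdist_sym maxnC. Qed.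

Let udist_triangle y x z : udist x z <= udist x y + udist y z.
Proof.
pose n := maxn (idx x) (maxn (idx y) (idx z)).
have xn : (idx x <= n)%N by rewrite leq_maxl.
have yn : (idx y <= n)%N by rewrite /n !leq_max leqnn orbT.
have zn : (idx z <= n)%N by rewrite /n !leq_max leqnn !orbT.
by rewrite !(@udistE n)//; exact: pdist_triangle.
Qed.

Let du : pseudometric R Q := Pseudometric udistxx udist_sym udist_triangle.

(** The list is treated at a stage [n] past the indices of its points. Their mutual distances are
    final there, and [inr n] is moved to the required position. *)
Let du_extension (l : seq code) : spread_list du (map decode l) ->
  exists v, forall c, c \in map decode l ->
    du v c.1 = min_ext du (map decode l) c.1.
Proof.
set L := map decode l => LP.
pose M := \max_(c <- L) idx c.1.
have [j Mj] := @inj_unbounded (fun j => choice.pickle (l, j))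
  ltac:(by move=> j j' /(pcan_inj choice.pickleK)[]) M.
set n := choice.pickle (l, j) in Mj.
have LE : codes n = L by rewrite /codes /n choice.pickleK.
have idxL c : c \in L -> (idx c.1 <= n)%N.
  by move=> cL; apply: leq_trans Mj; rewrite /M (big_rem c)//= leq_maxl.
have duE c c' : c \in L -> c' \in L -> du c.1 c'.1 = stage n c.1 c'.1.
  by move=> cL cL'; exact: udistE (idxL _ cL) (idxL _ cL').
have spread : spread_list (stage n) L.
  by have [L0 h] := LP; split=> // c c' cL cL'; rewrite -duE// h.
have extE c : c \in L -> min_ext du L c.1 = min_ext (stage n) L c.1.
  move=> cL; have [/eqP L0 _] := LP.
  have [c1 cL1 E1] := min_ext_attained du c.1 L0.
  have [c2 cL2 E2] := min_ext_attained (stage n) c.1 L0.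
  apply/eqP; rewrite eq_le {1}E2 -duE// min_ext_le//=.
  by rewrite E1 duE// min_ext_le.
exists (inr n) => c cL; rewrite extE// -LE.
have cn := idxL _ cL.
rewrite [LHS](@udistE n.+1) ?leqnn//; last exact: leqW.
rewrite /= LE add_point_new//.
by apply/eqP => E; move: cn; rewrite E /= ltnn.
Qed.

Definition urysohn_completion := completion du.
Let U : metricType R := urysohn_completion.
Let inU (x : Q) : U := in_completion du x.

Let coded_dense (u : U) (e : R) : 0 < e -> exists i, mdist u (inU (coded i)) < e.
Proof.
move=> e0; have [x ux] := in_completion_dense u (ltac:(lra) : 0 < e / 2).
have [i xi] : exists i, du x (coded i) < e / 2.
  case: x {ux} => [t|m]; last by exists (inr m); rewrite pdistxx; lra.
  by have [i ti] := ts_dense t (ltac:(lra) : 0 < e / 2); exists (inl i).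
exists i; apply: le_lt_trans (metric_triangle _ (inU x) _) _.
by rewrite [in X in _ + X]mdist_in_completion; lra.
Qed.

Let U_separable : separable U.
Proof.
exists [set inU (coded i) | i in [set: (nat + nat)%type]].
  exact: card_le_trans (card_image_le _ _) (countableP _).
have h (u : U) (e : R) : 0 < e ->
    exists2 v, [set inU (coded i) | i in [set: (nat + nat)%type]] v & mdist u v < e.
  by move=> /(coded_dense u)[i ui]; exists (inU (coded i)) => //; exists i.
exact ((denseP _).2 h).
Qed.

Local Arguments pdist : simpl never.

(** Centres are replaced by coded points and radii by rationals. The lower bound is conditional for
    each [c] separately because the correction step below adds a centre for which it is not
    asked. *)
Let approximate_extension (L : seq (U * R)) (e : R) : 0 < e ->
  (forall c c', c \in L -> c' \in L -> mdist c.1 c'.1 <= c.2 + c'.2) ->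
  exists v, forall c, c \in L -> mdist v c.1 <= c.2 + e /\
    ((forall c', c' \in L -> c.2 <= c'.2 + mdist c'.1 c.1) ->
     c.2 - e <= mdist v c.1).
Proof.
move=> e0 LP; have e3 : 0 < e / 3 by lra.
(* Each centre moves by less than [e / 3]; enlarging each radius by more than [e / 3] compensates,
   so the coded list stays spread. *)
have [->|L0] := eqVneq L [::]; first by exists (inU (coded (inr 0%N))).
have /choice[cd hcd] : forall c : U * R, exists k : code,
    mdist c.1 (inU (coded k.1)) < e / 3 /\
    c.2 + e / 3 < ratr k.2 < c.2 + 2 * (e / 3).
  move=> c; have [i hi] := coded_dense c.1 e3.
  have [q] := rat_in_itvoo (ltac:(lra) : c.2 + e / 3 < c.2 + 2 * (e / 3)).
  by rewrite in_itv/= => hq; exists (i, q).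
pose l := map cd L.
have lP k : k \in map decode l -> exists2 c, c \in L & k = decode (cd c).
  by move=> /mapP[_ /mapP[c cL ->] ->]; exists c.
have memL c : c \in L -> decode (cd c) \in map decode l.
  by move=> cL; do 2 apply: map_f.
have duE x y : du x y = mdist (inU x) (inU y) by rewrite mdist_in_completion.
have near_dist c c' : `|mdist (inU (coded (cd c).1)) (inU (coded (cd c').1)) -
    mdist c.1 c'.1| <= 2 * (e / 3).
  have [h _] := hcd c; have [h' _] := hcd c'.
  have := mdist_dist_le c.1 (inU (coded (cd c).1)) (inU (coded (cd c').1)).
  have := mdist_dist_le c'.1 (inU (coded (cd c').1)) c.1.
  rewrite (metric_sym c'.1 c.1) (metric_sym (inU (coded (cd c').1)) c.1).
  by rewrite !ler_norml; lra.
have spread : spread_list du (map decode l).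
  split; first by move: L0; rewrite /l; case: (L).
  move=> _ _ /lP[c cL ->] /lP[c' cL' ->] /=.
  have [_ h] := hcd c; have [_ h'] := hcd c'.
  have := near_dist c c'; have := LP c c' cL cL'.
  by rewrite duE ler_norml; lra.
have [v hv] := du_extension spread.
exists (inU v) => c cL.
have vE := hv _ (memL c cL); rewrite duE /= in vE.
have [h1 h2] := hcd c.
have vc : `|mdist (inU v) c.1 - mdist (inU v) (inU (coded (cd c).1))| <= e / 3.
  rewrite (metric_sym _ c.1) (metric_sym _ (inU (coded _))).
  exact: le_trans (mdist_dist_le _ _ _) (ltW h1).
split.
  have := @min_ext_le _ _ du _ _ (coded (cd c).1) (memL c cL).
  by rewrite -vE /= pdistxx; move: vc; rewrite ler_norml; lra.
move=> hc; have /(_ _)[|k /lP[c' cL' ->] kE] :=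
  @min_ext_attained _ _ du (map decode l) (coded (cd c).1).
  by have [/eqP] := spread.
have [h3 h4] := hcd c'; have := hc _ cL'; have := near_dist c' c.
move: kE vc; rewrite -vE /= duE !ler_norml => ->; lra.
Qed.

(** Successive correction: an approximant with error [half_pow n.+2] joins the list as a centre of
    that radius, so the next one is nearby with half the error. The limit has the exact
    distances. *)
Let exact_extension (L : seq (U * R)) :
  (forall c c', c \in L -> c' \in L ->
    mdist c.1 c'.1 <= c.2 + c'.2 /\ c.2 <= c'.2 + mdist c'.1 c.1) ->
  exists v, forall c, c \in L -> mdist v c.1 = c.2.
Proof.
move=> LP.
pose err n (v : U) := forall c, c \in L -> `|mdist v c.1 - c.2| <= half_pow n.+2.
have err0 : exists v, err 0%N v.
  have [|v hv] := @approximate_extension L (half_pow 2) (half_pow_gt0 _).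
    by move=> c c' cL cL'; have [] := LP c c' cL cL'.
  exists v => c cL; have [h1 /(_ _) h2] := hv c cL.
  have {}h2 := h2 (fun c' cL' => (LP c c' cL cL').2).
  by rewrite ler_norml; lra.
have next (p : nat * U) : exists v', err p.1 p.2 ->
    err p.1.+1 v' /\ mdist p.2 v' <= half_pow p.1.
  case: p => n v /=; have [he|] := pselect (err n v); last by exists v.
  have n0 := @half_pow_gt0 R n.+2.
  have errc c : c \in L -> c.2 <= half_pow n.+2 + mdist v c.1 /\
      mdist v c.1 <= half_pow n.+2 + c.2.
    by move=> /he; rewrite ler_norml; lra.
  have [|v' hv'] := @approximate_extension ((v, half_pow n.+2) :: L)
      (half_pow n.+3) (half_pow_gt0 _).
    move=> c c'; rewrite !inE => /orP[/eqP ->|cL] /orP[/eqP ->|cL'] /=.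
    - by rewrite mdistxx; lra.
    - by have [] := errc c' cL'.
    - by rewrite metric_sym addrC; have [] := errc c cL.
    - by have [] := LP c c' cL cL'.
  exists v' => _; split=> [c cL|].
    have [|h1 h2] := hv' c; first by rewrite inE cL orbT.
    have : c.2 - half_pow n.+3 <= mdist v' c.1.
      apply: h2 => c'; rewrite inE => /orP[/eqP -> /=|cL'].
        by have [] := errc c cL.
      by have [] := LP c c' cL cL'.
    by rewrite ler_norml; lra.
  have [|/= h1 _] := hv' (v, half_pow n.+2); first by rewrite mem_head.
  rewrite metric_sym; apply: le_trans h1 _.
  have := @half_powS R n; have := @half_powS R n.+1; have := @half_powS R n.+2; lra.
have [nx hnx] := choice next; have [v0 hv0] := err0.
pose v := fix v n : U := if n is m.+1 then nx (m, v m) else v0.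
have verr n : err n (v n).
  by elim: n => [//|n IH] /=; have [] := hnx (n, v n) IH.
have [|w hw] := (complete_spaceP _).1 (completion_complete (d := du)) v.
  by move=> n; have [] := hnx (n, v n) (verr n).
exists w => c cL; apply/eqP; rewrite -subr_eq0 -normr_le0.
apply/ler_addgt0Pl => e e0; rewrite addr0.
have [n hn] := @half_pow_small R (e / 3) ltac:(lra).
have := verr n c cL; have := hw n; have := mdist_dist_le (v n) w c.1.
have := @half_powS R n; have := @half_powS R n.+1; have := @half_pow_gt0 R n.+2.
by rewrite !ler_norml; lra.
Qed.

(** Points of [s] are placed one at a time, each by its prescribed distances to the points already
    placed. *)
Let finite_extension (B : metricType R) (A : set B) (f : A -> U) (s : seq B) :
  finite_set [set: B] -> isometric_embedding f ->
  exists g : B -> U, (forall b b', (b \in A) || (b \in s) ->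
      (b' \in A) || (b' \in s) -> mdist (g b) (g b') = mdist b b') /\
    forall a : A, g (set_val a) = f a.
Proof.
move=> /finite_seqP[r rB] fiso.
have inr' (b : B) : b \in r by have : [set: B] b by []; rewrite rB.
elim: s => [|b s [g [giso gf]]].
  pose g b :=
    if pselect (b \in A) is left h then f (SigSub h) else inU (coded (inr 0%N)).
  have gE (b : B) (h : b \in A) : g b = f (SigSub h).
    rewrite /g; case: pselect => // h'.
    by congr (f (SigSub _)); exact: Prop_irrelevance.
  exists g; split=> [b b'|a].
    by rewrite !in_nil !orbF => bA bA'; rewrite !gE fiso.
  by rewrite (gE _ (valP a)); congr f; exact: val_inj.
pose old (x : B) := (x \in A) || (x \in s).
have [ob|nb] := boolP (old b).
  exists g; split=> // c c' hc hc'; apply: giso.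
    by move: hc; rewrite inE; case: eqP => [->|].
  by move: hc'; rewrite inE; case: eqP => [->|].
pose L := [seq (g x, mdist x b) | x <- r & old x].
have [|v hv] := @exact_extension L.
  move=> _ _ /mapP[x + ->] /mapP[y + ->]; rewrite !mem_filter.
  move=> /andP[ox _] /andP[oy _] /=.
  rewrite !giso//; split.
    by have := metric_triangle x b y; rewrite (metric_sym b y).
  by have := metric_triangle x y b; rewrite (metric_sym x y); lra.
have vg x : old x -> mdist v (g x) = mdist x b.
  move=> ox; apply: (hv (g x, mdist x b)); apply/mapP; exists x => //.
  by rewrite mem_filter ox/=.
exists (fun x => if x == b then v else g x); split=> [x y|a]; last first.
  case: eqP => [ab|_]; last exact: gf.
  by move: nb; rewrite /old -ab (valP a).
have oldP z : [|| z \in A, z == b | z \in s] -> z <> b -> old z.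
  by rewrite /old; case: (z \in A) => //= /orP[/eqP|].
rewrite !inE => hx hy; case: eqP => [->|xb]; case: eqP => [->|yb].
- by rewrite !mdistxx.
- by rewrite vg 1?metric_sym//; exact: oldP.
- by rewrite metric_sym vg//; exact: oldP.
- by apply: giso; exact: oldP.
Qed.

Lemma urysohn_completion_urysohn : urysohn_space (urysohn_completion : metricType R).
Proof.
split; [exact: completion_complete|exact: U_separable|] => B A f finB fiso.
have /finite_seqP[r rB] := finB.
have [g [giso gf]] := finite_extension r finB fiso.
exists g; split=> // b b'.
have inr' (c : B) : c \in r by have : [set: B] c by []; rewrite rB.
by rewrite giso ?inr' ?orbT.
Qed.

Lemma urysohn_completion_embedding : exists i : T -> urysohn_completion,
  isometric_embedding i.
Proof.
by exists (fun t => inU (inl t)) => t t'; rewrite mdist_in_completion.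
Qed.

End urysohn.

(** * The implications between the four conditions *)

Lemma tree_image (R : realType) (X : metricType R) : [set: X] !=set0 ->
  [/\ analytic R X, lipschitz_connected X
    & exists cX : lipschitz_connected X, separable (intrinsic_space cX)] ->
  exists T : metricType R, [/\ separable T, injective_space T, R_tree T
    & lipschitz1_image_of X T].
Proof.
move=> [x0 _] [[P [sP cP [f [f_cont f_surj]]]] _ [cX sI]].
have [p0 _] : exists p, f p = x0.
  by have : [set: X] x0 by []; rewrite -f_surj => -[p _ <-]; exists p.
have P_neq0 : [set: P] !=set0 by exists p0.
have I_neq0 : [set: intrinsic_space cX] !=set0 by exists x0.
have [es es_dense] := (separableP P_neq0).1 sP.
have [xs xs_dense] := (separableP I_neq0).1 sI.
have [l [F [F_surj F1]]] :=
  ray_tree_parametrization x0 xs_dense p0 es_dense cP f_cont f_surj.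
exists (ray_tree (0, 0)%N l); split.
- exact: ray_tree_separable.
- exact: ray_tree_injective.
- exact: ray_tree_R_tree.
by exists F; split=> //; apply/lipschitz_with1P.
Qed.

Lemma lipschitz1_image_lipschitz (R : realType) (X Z : metricType R) :
  lipschitz1_image_of X Z -> lipschitz_image_of X Z.
Proof.
move=> [f [fsurj f1]]; exists f; split=> //.
by apply: (@le_lt_trans _ _ 1%:E); rewrite ?ltry.
Qed.

(** The Urysohn space built over [T] retracts onto [T] by injectivity, and the retraction is
    followed by [F]. *)
Lemma urysohn_image (R : realType) (X T : metricType R) : separable T ->
  injective_space T -> lipschitz1_image_of X T ->
  exists U : metricType R, urysohn_space U /\ lipschitz1_image_of X U.
Proof.
move=> sT iT [F [F_surj /lipschitz_with1P F1]].
have [ts ts_dense] := (separableP (injective_neq0 iT)).1 sT.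
have [i isoi] := urysohn_completion_embedding ts.
have [r [r1 rK]] := injective_retract iT isoi.
exists (urysohn_completion ts); split; first exact: urysohn_completion_urysohn.
exists (F \o r); split; last first.
  by apply/lipschitz_with1P => u u'; exact: le_trans (F1 _ _) (r1 _ _).
apply/seteqP; split=> // x _; have : [set: X] x by [].
by rewrite -F_surj => -[t _ <-]; exists (i t) => //=; rewrite rK.
Qed.

Theorem theorem1p4 (R : realType) (X : metricType R) (X_neq0 : [set: X] !=set0) :
  [<-> exists Z : metricType R,
         [/\ separable Z, injective_space Z & lipschitz_image_of X Z];
       exists T : metricType R,
         [/\ separable T, complete_space T, R_tree T & lipschitz_image_of X T];
       exists U : metricType R, urysohn_space U /\ lipschitz1_image_of X U;
       [/\ analytic R X, lipschitz_connected X
         & exists cX : lipschitz_connected X, separable (intrinsic_space cX)]].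
Proof.
tfae.
(* The cycle is (1), (2), (3), (4), (1). The first two implications pass through (4) and its tree,
   which is at once injective and an R-tree. *)
- move=> [Z [sZ iZ XZ]].
  have := geodesic_image sZ (injective_complete iZ) (injective_geodesic iZ) XZ.
  move=> /(tree_image X_neq0)[T [sT iT rT XT]]; exists T; split=> //.
    exact: injective_complete.
  exact: lipschitz1_image_lipschitz.
- move=> [T [sT cT rT XT]].
  have := geodesic_image sT cT (R_tree_geodesic rT) XT.
  by move=> /(tree_image X_neq0)[T' [sT' iT' _ XT']]; exact: urysohn_image XT'.
- move=> [U [uU XU]]; have [cU sU _] := uU.
  apply: geodesic_image sU cU (urysohn_geodesic uU) _.
  exact: lipschitz1_image_lipschitz.
- move=> /(tree_image X_neq0)[T [sT iT _ XT]]; exists T; split=> //.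
  exact: lipschitz1_image_lipschitz.
Qed.
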